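(* Let $k$ be a field. Let $\mathbf{QSh}=\bigoplus_{n\ge 0}\mathbf{QSh}_n$ be the vector space underlying the operad of quasi-shuffle algebras, where $\mathbf{QSh}_n$ has basis the tensors $x_{\mathcal I}=x_{I_1}\otimes\cdots\otimes x_{I_p}$ indexed by the ordered partitions $\mathcal I=(I_1,\dots,I_p)$ of $[n]=\{1,\dots,n\}$ into nonempty blocks ($\mathbf{QSh}_0=k\cdot 1$). Then $\mathbf{QSh}$ is a (unital) noncommutative quasi-shuffle (NQSh) bialgebra for the products defined, for $\mathcal I$ an ordered partition of $[n]$ and $\mathcal J$ an ordered partition of $[m]$ ($n,m\geq 1$), by $$x_{\mathcal I}\prec x_{\mathcal J}:=x_{\mathcal I}\prec_f x_{\mathcal J+n},\qquad x_{\mathcal I}\succ x_{\mathcal J}:=x_{\mathcal I}\succ_f x_{\mathcal J+n},\qquad x_{\mathcal I}\bullet x_{\mathcal J}:=x_{\mathcal I}\bullet_f x_{\mathcal J+n},$$ and for the coproduct $\Delta(x):=(st\otimes st)\circ\Delta_f(x)$, where $\prec_f,\succ_f,\bullet_f,\Delta_f$ are the corresponding operations of the quasi-shuffle bialgebra $k\oplus QSh(\mathbb N^* )$.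
   Context: $\mathbb N^*=\{1,2,\dots\}$. NQSh algebra: a nonunital associative algebra $(A,\bullet)$ with two further bilinear products $\prec,\succ$ such that, with $x\star y:=x\prec y+x\succ y+x\bullet y$, for all $x,y,z$: $(x\prec y)\prec z=x\prec(y\star z)$; $(x\succ y)\prec z=x\succ(y\prec z)$; $(x\star y)\succ z=x\succ(y\succ z)$; $(x\prec y)\bullet z=x\bullet(y\succ z)$; $(x\succ y)\bullet z=x\succ(y\bullet z)$; $(x\bullet y)\prec z=x\bullet(y\prec z)$. Unital version: $k\oplus A$ with, for $x\in A$, $1\bullet x=x\bullet 1=0$, $1\prec x=0$, $x\prec 1=x$, $1\succ x=x$, $x\succ 1=0$, and $1\star1=1$. NQSh bialgebra: a unital NQSh algebra $k\oplus A$ with a coassociative counital coproduct $\Delta$, $\Delta(1)=1\otimes 1$, such that, with $\tilde\Delta(a)=\Delta(a)-a\otimes1-1\otimes a=:a'\otimes a''$ for $a\in A$ (with $\tilde\Delta(A)\subseteq A\otimes A$), for all $x,y\in A$: $\tilde\Delta(x\prec y)=x'\prec y'\otimes x''\star y''+x'\otimes x''\star y+x\prec y'\otimes y''+x'\prec y\otimes x''+x\otimes y$; $\tilde\Delta(x\succ y)=x'\succ y'\otimes x''\star y''+y'\otimes x\star y''+x\succ y'\otimes y''+x'\succ y\otimes x''+y\otimes x$; $\tilde\Delta(x\bullet y)=x'\bullet y'\otimes x''\star y''+x'\bullet y\otimes x''+x\bullet y'\otimes y''$. $QSh(\mathbb N^* ):=T^+(W)=\bigoplus_{n\ge1}W^{\otimes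 n}$, where $W$ is the nonunital commutative algebra of polynomials without constant term in the variables $x_i$, $i\in\mathbb N^*$. Its operations are defined inductively, for $a,b\in W$ and tensors (words) $v,w\in T(W)$, by $av\prec_f bw=a(v\star_f bw)$, $av\succ_f bw=b(av\star_f w)$, $av\bullet_f bw=(a\cdot b)(v\star_f w)$, where $\star_f=\prec_f+\succ_f+\bullet_f$, $1\star_f v=v\star_f1=v$ and $a\cdot b$ is the product of $W$ (one has $x\succ_f y=y\prec_f x$). $\Delta_f$ is deconcatenation: $\Delta_f(w_1\cdots w_n)=\sum_{i=0}^n w_1\cdots w_i\otimes w_{i+1}\cdots w_n$. For a finite subset $I\subset\mathbb N^*$, $x_I=\prod_{i\in I}x_i\in W$. For a sequence $\mathcal I=(I_1,\dots,I_p)$ of disjoint nonempty finite subsets of $\mathbb N^*$, $x_{\mathcal I}=x_{I_1}\otimes\cdots\otimes x_{I_p}\in T^+(W)$; $\mathcal I+n$ is obtained by adding $n$ to every element of every block; $st(\mathcal I)$ is obtained by applying to every element of every block the unique increasing bijection from $I_1\sqcup\cdots\sqcup I_p$ onto $\{1,\dots,|I_1|+\cdots+|I_p|\}$, and $st(x_{\mathcal I}):=x_{st(\mathcal I)}$, $st(1)=1$. *)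

(* Defs.v *)
From HB Require Import structures.
From mathcomp Require Import all_boot all_order all_algebra.
From mathcomp Require Import finmap sesquilinear.
From mathcomp.multinomials Require Import monalg.

Set Implicit Arguments.
Unset Strict Implicit.
Unset Printing Implicit Defensive.

Import GRing.Theory.

Local Open Scope fset_scope.
Local Open Scope ring_scope.

(* {malg k[B]} is the vector space with basis B, the basis vector of b : B
   being << b >>. The free module on B * C is thus {malg k[B]} (x) {malg k[C]}, with
   << (b, c) >> = << b >> (x) << c >>. *)
Section FreeModules.
Context {k : fieldType}.

Definition linext {B : choiceType} {V : lmodType k} (f : B -> V)
    (u : {malg k[B]}) : V :=
  \sum_(b <- msupp u) u@_b *: f b.

Definition bilext {B C : choiceType} {V : lmodType k} (f : B -> C -> V)
    (u : {malg k[B]}) (v : {malg k[C]}) : V :=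
  \sum_(b <- msupp u) \sum_(c <- msupp v) (u@_b * v@_c) *: f b c.

Definition tens {B C : choiceType} (u : {malg k[B]}) (v : {malg k[C]}) :
    {malg k[(B * C)%type]} :=
  bilext (fun b c => << (b, c) >>) u v.

(* f (x) g, for linear maps f and g *)
Definition tmap {B C B' C' : choiceType}
    (f : {malg k[B]} -> {malg k[B']}) (g : {malg k[C]} -> {malg k[C']})
    (t : {malg k[(B * C)%type]}) : {malg k[(B' * C')%type]} :=
  linext (fun p => tens (f << p.1 >>) (g << p.2 >>)) t.

(* s' (x) s'', t' (x) t'' |-> f s' t' (x) g s'' t'', for bilinear f and g *)
Definition tmap2 {B C : choiceType}
    (f : {malg k[B]} -> {malg k[B]} -> {malg k[B]})
    (g : {malg k[C]} -> {malg k[C]} -> {malg k[C]})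
    (s t : {malg k[(B * C)%type]}) : {malg k[(B * C)%type]} :=
  bilext (fun p q => tens (f << p.1 >> << q.1 >>) (g << p.2 >> << q.2 >>)) s t.

(* (U (x) V) (x) W ~ U (x) (V (x) W) *)
Definition tassoc {B C D : choiceType} (t : {malg k[((B * C) * D)%type]}) :
    {malg k[(B * (C * D))%type]} :=
  linext (fun p => << (p.1.1, (p.1.2, p.2)) >>) t.

Definition counit_l {B C : choiceType} (eps : {malg k[B]} -> k)
    (t : {malg k[(B * C)%type]}) : {malg k[C]} :=
  linext (fun p => eps << p.1 >> *: << p.2 >>) t.

Definition counit_r {B C : choiceType} (eps : {malg k[C]} -> k)
    (t : {malg k[(B * C)%type]}) : {malg k[B]} :=
  linext (fun p => eps << p.2 >> *: << p.1 >>) t.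

End FreeModules.

(* A unital NQSh algebra k (+) A is carried by H = {malg k[B]}, where B is a
   basis with a distinguished element e: the unit is << e >> and A is the span
   of the other basis elements. *)
Section NQSh.
Context {k : fieldType} {B : choiceType} (e : B).
Local Notation H := {malg k[B]}.
Local Notation HH := {malg k[(B * B)%type]}.
Implicit Types (op prec succ bullet : H -> H -> H) (Delta : H -> HH).

Definition in_A (x : H) : Prop := x@_e = 0.

Definition in_AA (t : HH) : Prop :=
  forall b c, (b == e) || (c == e) -> t@_(b, c) = 0.

(* 1 < 1, 1 > 1 and 1 . 1 are undefined in a unital NQSh algebra. To have total
   bilinear operations they are set to 0 in [nqsh_unital] below; the
   convention 1 * 1 = 1 is then provided by the last summand, which vanishes
   as soon as one of x and y is in A. *)
Definition nqstar prec succ bullet (x y : H) : H :=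
  prec x y + succ x y + bullet x y + (x@_e * y@_e) *: << e >>.

Record nqsh_algebra prec succ bullet : Prop := {
  nqsh_prec_bilinear : bilinear_for *:%R *:%R prec;
  nqsh_succ_bilinear : bilinear_for *:%R *:%R succ;
  nqsh_bullet_bilinear : bilinear_for *:%R *:%R bullet;
  nqsh_prec_closed : forall x y, in_A x -> in_A y -> in_A (prec x y);
  nqsh_succ_closed : forall x y, in_A x -> in_A y -> in_A (succ x y);
  nqsh_bullet_closed : forall x y, in_A x -> in_A y -> in_A (bullet x y);
  nqsh_bulletA : forall x y z, in_A x -> in_A y -> in_A z ->
    bullet (bullet x y) z = bullet x (bullet y z);
  nqsh_prec_prec : forall x y z, in_A x -> in_A y -> in_A z ->
    prec (prec x y) z = prec x (nqstar prec succ bullet y z);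
  nqsh_succ_prec : forall x y z, in_A x -> in_A y -> in_A z ->
    prec (succ x y) z = succ x (prec y z);
  nqsh_star_succ : forall x y z, in_A x -> in_A y -> in_A z ->
    succ (nqstar prec succ bullet x y) z = succ x (succ y z);
  nqsh_prec_bullet : forall x y z, in_A x -> in_A y -> in_A z ->
    bullet (prec x y) z = bullet x (succ y z);
  nqsh_succ_bullet : forall x y z, in_A x -> in_A y -> in_A z ->
    bullet (succ x y) z = succ x (bullet y z);
  nqsh_bullet_prec : forall x y z, in_A x -> in_A y -> in_A z ->
    prec (bullet x y) z = bullet x (prec y z)
}.

Record nqsh_unital prec succ bullet : Prop := {
  nqsh_bullet1x : forall x, in_A x -> bullet << e >> x = 0;
  nqsh_bulletx1 : forall x, in_A x -> bullet x << e >> = 0;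
  nqsh_prec1x : forall x, in_A x -> prec << e >> x = 0;
  nqsh_precx1 : forall x, in_A x -> prec x << e >> = x;
  nqsh_succ1x : forall x, in_A x -> succ << e >> x = x;
  nqsh_succx1 : forall x, in_A x -> succ x << e >> = 0;
  nqsh_prec11 : prec << e >> << e >> = 0;
  nqsh_succ11 : succ << e >> << e >> = 0;
  nqsh_bullet11 : bullet << e >> << e >> = 0
}.

Definition coassociative Delta : Prop :=
  forall x, tassoc (tmap Delta id (Delta x)) = tmap id Delta (Delta x).

Definition counital Delta : Prop :=
  exists eps : H -> k,
    [/\ linear_for *%R eps,
        forall x, counit_l eps (Delta x) = x &
        forall x, counit_r eps (Delta x) = x].

Definition redcoprod Delta (a : H) : HH :=
  Delta a - tens a << e >> - tens << e >> a.

Record nqsh_bialgebra prec succ bullet Delta : Prop := {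
  nqsh_bialgebra_algebra : nqsh_algebra prec succ bullet;
  nqsh_bialgebra_unital : nqsh_unital prec succ bullet;
  nqsh_coprod_linear : linear Delta;
  nqsh_coprodA : coassociative Delta;
  nqsh_coprod_counital : counital Delta;
  nqsh_coprod1 : Delta << e >> = << (e, e) >>;
  nqsh_redcoprod_AA : forall a, in_A a -> in_AA (redcoprod Delta a);
  nqsh_redcoprod_prec : forall x y, in_A x -> in_A y ->
    redcoprod Delta (prec x y) =
      tmap2 prec (nqstar prec succ bullet)
        (redcoprod Delta x) (redcoprod Delta y)
      + tmap id (fun x'' => nqstar prec succ bullet x'' y) (redcoprod Delta x)
      + tmap (fun y' => prec x y') id (redcoprod Delta y)
      + tmap (fun x' => prec x' y) id (redcoprod Delta x)
      + tens x y;
  nqsh_redcoprod_succ : forall x y, in_A x -> in_A y ->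
    redcoprod Delta (succ x y) =
      tmap2 succ (nqstar prec succ bullet)
        (redcoprod Delta x) (redcoprod Delta y)
      + tmap id (fun y'' => nqstar prec succ bullet x y'') (redcoprod Delta y)
      + tmap (fun y' => succ x y') id (redcoprod Delta y)
      + tmap (fun x' => succ x' y) id (redcoprod Delta x)
      + tens y x;
  nqsh_redcoprod_bullet : forall x y, in_A x -> in_A y ->
    redcoprod Delta (bullet x y) =
      tmap2 bullet (nqstar prec succ bullet)
        (redcoprod Delta x) (redcoprod Delta y)
      + tmap (fun x' => bullet x' y) id (redcoprod Delta x)
      + tmap (fun y' => bullet x y') id (redcoprod Delta y)
}.

End NQSh.

(* The variables x_i are indexed by N^* = {1, 2, ...}. *)
Definition Npos := {i : nat | (0 < i)%N}.

Definition posS (i : nat) : Npos := Sub i.+1 (ltn0Sn i).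

(* The nontrivial monomials in the x_i form a basis of W, so that the words in
   nontrivial monomials form a basis of T(W) (the empty word being the unit 1)
   and the nonempty ones a basis of T^+(W). *)
Definition monW := {m : {cmonom Npos} | m != mone}.

Definition wordW := seq monW.

Lemma monW_mul_subproof (a b : monW) : mmul (val a) (val b) != mone.
Proof. by rewrite cmM_eq1 negb_and (valP a). Qed.

Definition monW_mul (a b : monW) : monW :=
  Sub (mmul (val a) (val b)) (monW_mul_subproof a b).

(* The quasi-shuffle operations on T(W) are the multilinear extensions of those
   on words in monomials; the latter are closed under the defining recursions,
   a product of two monomials being a monomial. *)
Section QuasiShuffle.
Context {k : fieldType}.
Local Notation TW := {malg k[wordW]}.

Definition lprod (a : monW) (u : TW) : TW := linext (fun w => << a :: w >>) u.

Fixpoint wstar (v w : wordW) {struct v} : TW :=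
  match v with
  | [::] => << w >>
  | a :: v' =>
    (fix wstar_v (w : wordW) : TW :=
       match w with
       | [::] => << v >>
       | b :: w' =>
         lprod a (wstar v' w) + lprod b (wstar_v w')
         + lprod (monW_mul a b) (wstar v' w')
       end) w
  end.

(* If exactly one of v and w is empty, these definitions yield the unital
   conventions 1 < w = 0, v < 1 = v, 1 > w = w, v > 1 = 0, 1 . w = v . 1 = 0.
   The values at (1, 1) are irrelevant. *)
Definition wprec (v w : wordW) : TW :=
  if v is a :: v' then lprod a (wstar v' w) else 0.

Definition wsucc (v w : wordW) : TW :=
  if w is b :: w' then lprod b (wstar v w') else 0.

Definition wbullet (v w : wordW) : TW :=
  if v is a :: v' then
    if w is b :: w' then lprod (monW_mul a b) (wstar v' w') else 0
  else 0.

Lemma wstarE a b (v w : wordW) :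
  wstar (a :: v) (b :: w) =
    wprec (a :: v) (b :: w) + wsucc (a :: v) (b :: w)
    + wbullet (a :: v) (b :: w).
Proof. by []. Qed.

Definition prec_f : TW -> TW -> TW := bilext wprec.
Definition succ_f : TW -> TW -> TW := bilext wsucc.
Definition bullet_f : TW -> TW -> TW := bilext wbullet.

Definition Delta_f : TW -> {malg k[(wordW * wordW)%type]} :=
  linext (fun w : wordW => \sum_(i < (size w).+1) << (take i w, drop i w) >>).

End QuasiShuffle.

(* A finite nonempty subset of N^*. *)
Definition block := {I : {fset Npos} | I != fset0}.

Lemma block_map_subproof (f : Npos -> Npos) (I : block) :
  [fset f i | i in val I] != fset0.
Proof.
case: I => I /= /fset0Pn[i iI]; apply/fset0Pn; exists (f i).
by apply/imfsetP; exists i.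
Qed.

Definition block_map (f : Npos -> Npos) (I : block) : block :=
  Sub [fset f i | i in val I] (block_map_subproof f I).

Definition cover (s : seq block) : {fset Npos} := \bigcup_(I <- s) val I.

Definition disjoint_blocks (s : seq block) : bool :=
  pairwise (fun I J : block => [disjoint val I & val J]) s.

(* I + n *)
Definition shift (n : nat) (s : seq block) : seq block :=
  map (block_map (fun i => Sub (val i + n)%N (ltn_addr n (valP i)))) s.

(* On U, the increasing bijection from U onto {1, ..., #|U|}. *)
Definition rank_in (U : {fset Npos}) (i : Npos) : Npos :=
  posS #|` [fset j in U | (val j < val i)%N] |.

Definition st_blocks (s : seq block) : seq block :=
  map (block_map (rank_in (cover s))) s.

Definition x_set (I : {fset Npos}) : {cmonom Npos} :=
  \big[@mmul _/mone]_(i <- I) ucm i.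

Lemma x_setE (I : {fset Npos}) j : x_set I j = (j \in I).
Proof.
rewrite /x_set (big_morph (fun m : {cmonom Npos} => m j)
  (id1 := 0%N) (op1 := addn)); last 2 first.
- by move=> a b; rewrite cmM.
- by rewrite cm1.
under eq_bigr do rewrite cmU.
case: (boolP (j \in I)) => [jI|jNI].
  rewrite (big_fsetD1 j) //= eqxx big_seq big1 ?addn0 // => i.
  by rewrite !inE => /andP[/negPf -> _].
rewrite big_seq big1 // => i iI.
by apply/eqP; rewrite eqb0; apply: contraNneq jNI => <-.
Qed.

Lemma supp_x_set (I : {fset Npos}) : finsupp (x_set I) = I.
Proof. by apply/fsetP => j; rewrite -cmE_neq0 x_setE; case: (j \in I). Qed.

Lemma x_block_subproof (I : block) : x_set (val I) != mone.
Proof.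
apply: contraTneq (valP I) => eqI1.
by rewrite negbK -(supp_x_set (val I)) eqI1 mdom1.
Qed.

Definition x_block (I : block) : monW := Sub (x_set (val I)) (x_block_subproof I).

Definition x_seq (s : seq block) : wordW := map x_block s.

Lemma supp_subproof (m : monW) : finsupp (val m) != fset0.
Proof.
apply: contraNneq (valP m) => supp0; apply/cmP => i.
by rewrite cm1; apply/eqP; rewrite cmE_eq0 supp0 inE.
Qed.

(* The set of the variables occurring in m; it recovers I from x_I. *)
Definition supp (m : monW) : block := Sub (finsupp (val m)) (supp_subproof m).

Lemma x_blockK : cancel x_block supp.
Proof. by move=> I; apply: val_inj; rewrite /= supp_x_set. Qed.

(* Only the values at the words x_I, for I a sequence of disjoint blocks, are
   meaningful: they are given by [st_wordE]. *)
Definition st_word (w : wordW) : wordW := x_seq (st_blocks (map supp w)).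

Lemma st_wordE (s : seq block) : st_word (x_seq s) = x_seq (st_blocks s).
Proof. by rewrite /st_word /x_seq (mapK x_blockK). Qed.

Definition st_f {k : fieldType} : {malg k[wordW]} -> {malg k[wordW]} :=
  linext (fun w => << st_word w >>).

(* s is an ordered partition of {1, ..., n} *)
Definition is_ordpart (n : nat) (s : seq block) : bool :=
  disjoint_blocks s && (cover s == [fset posS i | i in iota 0 n]).

(* The ordered partitions of {1, ..., n} for all n >= 0; n is recovered as the
   number of elements covered by the blocks. *)
Definition ordpart_pred (s : seq block) : bool := is_ordpart #|` cover s | s.

Definition ordpart := {s : seq block | ordpart_pred s}.

Definition deg (I : ordpart) : nat := #|` cover (val I) |.

Lemma is_ordpart_deg n (s : seq block) : is_ordpart n s -> #|` cover s | = n.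
Proof.
case/andP=> _ /eqP ->; rewrite card_imfset /=; last by move=> i j [].
by rewrite undup_id ?size_iota ?iota_uniq.
Qed.

Lemma ordpart0_subproof : ordpart_pred [::].
Proof.
rewrite /ordpart_pred /is_ordpart /cover big_nil cardfs0 /=; apply/eqP/fsetP => i.
by rewrite in_fset0; apply/esym/negbTE/imfsetP => -[].
Qed.

Definition ordpart0 : ordpart := Sub [::] ordpart0_subproof.

Notation QSh k := {malg k[ordpart]}.

(* The inclusion of QSh into T(W). *)
Definition emb {k : fieldType} : QSh k -> {malg k[wordW]} :=
  linext (fun I => << x_seq (val I) >>).

(* emb and emb (x) emb are injective: operations on QSh are determined by their
   images in T(W). *)
Lemma x_seq_inj : injective x_seq.
Proof. exact: inj_map (can_inj x_blockK). Qed.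

Lemma mcoeff_emb (k : fieldType) (u : QSh k) (I : ordpart) :
  (emb u)@_(x_seq (val I)) = u@_I.
Proof.
rewrite {2}[u]monalgE /emb /linext !raddf_sum /=; apply: eq_bigr => J _.
rewrite mcoeffZ !mcoeffU (inj_eq x_seq_inj) (inj_eq val_inj).
by case: (J == I); rewrite ?mulr1 ?mulr0.
Qed.

Lemma emb_inj (k : fieldType) : injective (@emb k).
Proof. by move=> u v e; apply/malgP => I; rewrite -!mcoeff_emb e. Qed.

Lemma tens11 (k : fieldType) (B C : choiceType) (b : B) (c : C) :
  tens << b >> << c >> = << (b, c) >> :> {malg k[(B * C)%type]}.
Proof.
rewrite /tens /bilext !msuppU oner_eq0 !big_seq_fset1 !mcoeffUU.
by rewrite mulr1 scale1r.
Qed.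

Lemma emb1 (k : fieldType) I :
  emb << I >> = << x_seq (val I) >> :> {malg k[wordW]}.
Proof. by rewrite /emb /linext msuppU oner_eq0 big_seq_fset1 mcoeffUU scale1r. Qed.

Lemma tmap_emb_inj (k : fieldType) : injective (tmap (@emb k) (@emb k)).
Proof.
have co u I J :
    (tmap (@emb k) (@emb k) u)@_(x_seq (val I), x_seq (val J)) = u@_(I, J).
  rewrite {2}[u]monalgE /tmap /linext !raddf_sum /=; apply: eq_bigr => -[K L] _.
  rewrite !emb1 tens11 mcoeffZ !mcoeffU !xpair_eqE !(inj_eq x_seq_inj).
  rewrite !(inj_eq val_inj).
  by case: (_ && _); rewrite ?mulr1 ?mulr0.
by move=> u v e; apply/malgP => -[I J]; rewrite -!co e.
Qed.

(* Main.v *)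
Require Import Defs.
From HB Require Import structures.
From mathcomp Require Import all_boot all_order all_algebra.
From mathcomp Require Import finmap sesquilinear.
From mathcomp.multinomials Require Import monalg.

Set Implicit Arguments.
Unset Strict Implicit.
Unset Printing Implicit Defensive.

Import GRing.Theory.

Local Open Scope fset_scope.
Local Open Scope ring_scope.

(* The quasi-shuffle products on T(W) satisfy the NQSh axioms on all words, since
   both sides of each axiom peel off the same first letter and the rest is the
   associativity of the star product; deconcatenation satisfies the coproduct
   identities for the same reason.

   To transport this to ordered partitions, extend standardization linearly to
   stdl : T(W) -> QSh. All the words of a quasi-shuffle product of v and w have
   the same content (the product of their letters), so that standardizing them
   is one and the same relabelling of the variables, and quasi-shuffle products
   commute with relabellings. As the relabelling sends v to st(v) and w to the
   shift of st(w) when the variables of v precede those of w, stdl turns the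
   products of T(W) into those of QSh on such words, and deconcatenation into
   Delta. Every basis triple of QSh lifts to three words with increasing disjoint
   sets of variables, whence all the identities. *)

(** * Linear and bilinear extensions *)

Section LinearExtensions.
Context {k : fieldType}.
Implicit Types (B C D : choiceType) (V W : lmodType k).

(** Standardization is not multiplicative on T(W): it forgets how the variables of two words
    interleave, and relabelling a monomial through its support loses squares. Products are therefore
    compared only when the contents are [separated]. This is a condition on multidegrees, so that it
    also makes sense for the sums of words that arise as inner products of an axiom. The transport
    asks nothing of a product but [natural_op], so that one lemma serves all the axioms. The star
    product is carried along as a fourth operation with its own recursion, instead of being summed
    from the other three; [nqstarE] identifies it at the end with the star product of the NQSh
    structure, including the convention 1 * 1 = 1. The three compatibilities with the coproduct come
    from the single formula [Delta (o x y) = tens 1 (o x y) + tmap2 o star (Delta x) (Delta y)];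
    after passing to reduced coproducts they differ only through the values of [o] at the unit. *)

(** The supports of [u], [v] and [c *: u + v] differ, so linearity is checked after enlarging the
    three sums to a common index set; the added terms have coefficient 0. *)
Lemma linextEw B V (f : B -> V) (d : {fset B}) (u : {malg k[B]}) :
  msupp u `<=` d -> linext f u = \sum_(b <- d) u@_b *: f b.
Proof.
move=> ud; rewrite /linext; apply: big_fset_incl => // b _ bNu.
by rewrite mcoeff_outdom // scale0r.
Qed.

Lemma linext_linear B V (f : B -> V) : linear (linext f).
Proof.
move=> c u v; pose d := msupp u `|` msupp v `|` msupp (c *: u + v).
rewrite !(@linextEw _ _ f d).
- rewrite scaler_sumr -big_split; apply: eq_bigr => b _ /=.
  by rewrite mcoeffD mcoeffZ scalerDl scalerA.
- by rewrite /d -fsetUA fsetUCA fsubsetUl.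
- by rewrite /d -fsetUA fsubsetUl.
- by rewrite /d fsubsetUr.
Qed.

HB.instance Definition _ B V (f : B -> V) :=
  GRing.isLinear.Build k {malg k[B]} V *:%R (linext f) (linext_linear f).

Lemma linextU B V (f : B -> V) (b : B) : linext f << b >> = f b.
Proof. by rewrite /linext msuppU oner_eq0 big_seq_fset1 mcoeffUU scale1r. Qed.

Lemma linext_basis B (u : {malg k[B]}) : linext (fun b => << b >>) u = u.
Proof.
rewrite [RHS]monalgE /linext; apply: eq_bigr => b _; apply/malgP => c.
by rewrite mcoeffZ !mcoeffU mulr_natr.
Qed.

Lemma linear_linext B V W (f : B -> V) (F : V -> W) : linear F ->
  forall u, F (linext f u) = linext (F \o f) u.
Proof.
move=> linF u; pose FM := GRing.isLinear.Build k V W *:%R F linF.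
pose G : {linear V -> W} := HB.pack F FM.
rewrite -[F]/(G : V -> W) /linext raddf_sum; apply: eq_bigr => b _.
exact: (linearZ_LR G).
Qed.

(** Comparing on the support only lets hypotheses on [u], such as homogeneity or membership in [A],
    reach each basis element that occurs. *)
Lemma eq_linear_on B V (f g : {malg k[B]} -> V) (u : {malg k[B]}) :
  linear f -> linear g -> {in msupp u, forall b, f << b >> = g << b >>} ->
  f u = g u.
Proof.
move=> linf ling fg; rewrite -[u]linext_basis !linear_linext // /linext.
by apply: eq_big_seq => b bu /=; rewrite fg.
Qed.

Lemma eq_linear B V (f g : {malg k[B]} -> V) :
  linear f -> linear g -> (forall b, f << b >> = g << b >>) -> f =1 g.
Proof. by move=> linf ling fg u; apply: eq_linear_on => // b _. Qed.

Lemma eq_bilinear B C V (f g : {malg k[B]} -> {malg k[C]} -> V) :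
  (forall y, linear (f^~ y)) -> (forall x, linear (f x)) ->
  (forall y, linear (g^~ y)) -> (forall x, linear (g x)) ->
  (forall b c, f << b >> << c >> = g << b >> << c >>) ->
  forall x y, f x y = g x y.
Proof.
move=> f1 f2 g1 g2 fg x y.
apply: (eq_linear (f := f^~ y) (g := g^~ y)) => // b.
exact: (eq_linear (f := f << b >>) (g := g << b >>)).
Qed.

Lemma bilextE B C V (f : B -> C -> V) u v :
  bilext f u v = linext (fun b => linext (f b) v) u.
Proof.
rewrite /bilext /linext; apply: eq_bigr => b _; rewrite scaler_sumr.
by apply: eq_bigr => c _; rewrite scalerA.
Qed.

(** Exchanging the arguments turns linearity in the second one into linearity in the first. *)
Lemma bilextC B C V (f : B -> C -> V) u v :
  bilext f u v = bilext (fun c b => f b c) v u.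
Proof.
rewrite /bilext exchange_big; apply: eq_bigr => b _; apply: eq_bigr => c _.
by rewrite mulrC.
Qed.

Lemma bilext_bilinear B C V (f : B -> C -> V) :
  bilinear_for *:%R *:%R (bilext f).
Proof.
split=> [v|u] c x y; last rewrite bilextC [X in _ = _ *: X + _]bilextC.
  by rewrite !bilextE linearP.
by rewrite [X in _ = _ + X]bilextC !bilextE linearP.
Qed.

HB.instance Definition _ B C V (f : B -> C -> V) :=
  bilinear_isBilinear.Build k {malg k[B]} {malg k[C]} V *:%R *:%R (bilext f)
    (bilext_bilinear f).

HB.instance Definition _ B C := Bilinear.copy (@tens k B C) (bilext _).
HB.instance Definition _ B C f g := Bilinear.copy (@tmap2 k B C f g) (bilext _).
HB.instance Definition _ B C D E f g :=
  GRing.Linear.copy (@tmap k B C D E f g) (linext _).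
HB.instance Definition _ B C D :=
  GRing.Linear.copy (@tassoc k B C D) (linext _).
HB.instance Definition _ B C eps :=
  GRing.Linear.copy (@counit_l k B C eps) (linext _).
HB.instance Definition _ B C eps :=
  GRing.Linear.copy (@counit_r k B C eps) (linext _).

Lemma bilextU B C V (f : B -> C -> V) b c : bilext f << b >> << c >> = f b c.
Proof. by rewrite bilextE !linextU. Qed.

Lemma tmapU B C B' C' (f : {malg k[B]} -> {malg k[B']})
    (g : {malg k[C]} -> {malg k[C']}) b c :
  tmap f g << (b, c) >> = tens (f << b >>) (g << c >>).
Proof. exact: linextU. Qed.

Lemma tmap2U B C f g (p q : B * C) :
  tmap2 f g << p >> << q >> =
    tens (f << p.1 >> << q.1 >>) (g << p.2 >> << q.2 >>) :> {malg k[_]}.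
Proof. exact: bilextU. Qed.

Lemma tmap_tens B C B' C' (f : {malg k[B]} -> {malg k[B']})
    (g : {malg k[C]} -> {malg k[C']}) u v : linear f -> linear g ->
  tmap f g (tens u v) = tens (f u) (g v).
Proof.
move=> linf ling; move: u; apply: eq_linear.
- by move=> c x y; rewrite linearPl linearP.
- by move=> c x y; rewrite linf linearPl.
move=> b; move: v; apply: eq_linear.
- by move=> c x y; rewrite linearPr linearP.
- by move=> c x y; rewrite ling linearPr.
by move=> c; rewrite tens11 tmapU.
Qed.

Lemma tmap2_tens B C f g (u u' : {malg k[B]}) (v v' : {malg k[C]}) :
  bilinear_for *:%R *:%R f -> bilinear_for *:%R *:%R g ->
  tmap2 f g (tens u v) (tens u' v') = tens (f u u') (g v v').
Proof.
move=> [fl fr] [gl gr]; move: u; apply: eq_linear => [c x y|c x y|b].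
- by rewrite (linearPl (@tens k B C)) linearPl.
- by rewrite fl linearPl.
move: v; apply: eq_linear => [c x y|c x y|c].
- by rewrite linearPr linearPl.
- by rewrite gl linearPr.
move: u'; apply: eq_linear => [d x y|d x y|b'].
- by rewrite linearPl linearPr.
- by rewrite fr linearPl.
move: v'; apply: eq_linear => [d x y|d x y|c'].
- by rewrite (linearPr (@tens k B C)) linearPr.
- by rewrite gr linearPr.
by rewrite !tens11 tmap2U.
Qed.

Lemma mcoeff_tens B C (u : {malg k[B]}) (v : {malg k[C]}) b c :
  (tens u v)@_(b, c) = u@_b * v@_c.
Proof.
move: u v; apply: (eq_bilinear (V := k^o) (f := fun u v => (tens u v)@_(b, c))
  (g := fun u v => u@_b * v@_c)) => [v|u|v|u|b' c'].
- by move=> d x y; rewrite linearPl mcoeffD mcoeffZ.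
- by move=> d x y; rewrite linearPr mcoeffD mcoeffZ.
- by move=> d x y; rewrite mcoeffD mcoeffZ mulrDl -mulrA.
- by move=> d x y; rewrite mcoeffD mcoeffZ mulrDr mulrCA.
by rewrite tens11 !mcoeffU xpair_eqE; do 2!case: eqP; rewrite ?mulr1 ?mulr0.
Qed.

(** With [b] the unit, this turns a counit law into the coefficients of the coproduct at the pairs
    containing the unit. *)
Lemma mcoeff_counit_l B C (b : B) (c : C) (t : {malg k[(B * C)%type]}) :
  (counit_l (mcoeff b) t)@_c = t@_(b, c).
Proof.
move: t; apply: (eq_linear (V := k^o) (f := fun t => (counit_l (mcoeff b) t)@_c)
  (g := mcoeff (b, c))) => [d x y|d x y|[b' c']].
- by rewrite linearP mcoeffD mcoeffZ.
- by rewrite mcoeffD mcoeffZ.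
rewrite [counit_l _ _]linextU mcoeffZ !mcoeffU xpair_eqE.
by do 2!case: eqP; rewrite ?mulr1 ?mulr0.
Qed.

Lemma mcoeff_counit_r B C (b : B) (c : C) (t : {malg k[(B * C)%type]}) :
  (counit_r (mcoeff c) t)@_b = t@_(b, c).
Proof.
move: t; apply: (eq_linear (V := k^o) (f := fun t => (counit_r (mcoeff c) t)@_b)
  (g := mcoeff (b, c))) => [d x y|d x y|[b' c']].
- by rewrite linearP mcoeffD mcoeffZ.
- by rewrite mcoeffD mcoeffZ.
rewrite [counit_r _ _]linextU mcoeffZ !mcoeffU xpair_eqE.
by do 2!case: eqP; rewrite ?mulr1 ?mulr0.
Qed.

Lemma tmap2_tensr B C f g (t : {malg k[(B * C)%type]}) y z :
  bilinear_for *:%R *:%R f -> bilinear_for *:%R *:%R g ->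
  tmap2 f g t (tens y z) = tmap (f^~ y) (g^~ z) t.
Proof.
move=> fb gb; move: t; apply: eq_linear => [c s t|c s t|[b c]].
- by rewrite linearPl.
- by rewrite linearP.
by rewrite tmapU -tens11; exact: tmap2_tens.
Qed.

Lemma tmap2_tensl B C f g (t : {malg k[(B * C)%type]}) y z :
  bilinear_for *:%R *:%R f -> bilinear_for *:%R *:%R g ->
  tmap2 f g (tens y z) t = tmap (f y) (g z) t.
Proof.
move=> fb gb; move: t; apply: eq_linear => [c s t|c s t|[b c]].
- by rewrite linearPr.
- by rewrite linearP.
by rewrite tmapU -tens11; exact: tmap2_tens.
Qed.

Lemma eq_tmap_on B C B' C' (f f' : {malg k[B]} -> {malg k[B']})
    (g g' : {malg k[C]} -> {malg k[C']}) (t : {malg k[(B * C)%type]}) :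
  {in msupp t, forall p, f << p.1 >> = f' << p.1 >>} ->
  {in msupp t, forall p, g << p.2 >> = g' << p.2 >>} ->
  tmap f g t = tmap f' g' t.
Proof.
move=> ff gg; apply: eq_big_seq => p pt.
exact: (congr1 (fun z => t@_p *: z) (congr2 tens (ff p pt) (gg p pt))).
Qed.

End LinearExtensions.

(** * Quasi-shuffle products of words *)

(** The argument [ext] says that the vectors [e t] determine linear maps; as a parameter, it covers
    both words in an abstract space and the basis of [QSh]. *)
Lemma eq_trilinear {k : fieldType} {T : Type} {V : lmodType k} (e : T -> V)
    (ext : forall f g : V -> V, linear f -> linear g ->
      (forall t, f (e t) = g (e t)) -> f =1 g)
    (f g : V -> V -> V -> V) :
  (forall y u, linear (fun x => f x y u)) -> (forall x u, linear (f x ^~ u)) ->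
  (forall x y, linear (f x y)) ->
  (forall y u, linear (fun x => g x y u)) -> (forall x u, linear (g x ^~ u)) ->
  (forall x y, linear (g x y)) ->
  (forall s t r, f (e s) (e t) (e r) = g (e s) (e t) (e r)) ->
  forall x y u, f x y u = g x y u.
Proof.
move=> f1 f2 f3 g1 g2 g3 fg x y u.
apply: (ext (fun x => f x y u) (fun x => g x y u)) => // s.
apply: (ext ((f (e s))^~ u) ((g (e s))^~ u)) => // t.
exact: (ext (f (e s) (e t)) (g (e s) (e t))).
Qed.

(** * The NQSh identities derived from the first-letter recursions *)

Section AbstractQuasiShuffle.
Context {k : fieldType} {S : Type} (mul : S -> S -> S) (mulA : associative mul).
Context {V : lmodType k} (word : seq S -> V) (lcons : S -> {linear V -> V}).
Context (prec succ bullet star : {bilinear V -> V -> V}).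
Implicit Types (a b c : S) (v w z : seq S) (x y u : V).
Hypothesis ext : forall f g : V -> V, linear f -> linear g ->
  (forall w, f (word w) = g (word w)) -> f =1 g.
Hypothesis lconsE : forall a w, lcons a (word w) = word (a :: w).
Hypothesis star1x : forall y, star (word [::]) y = y.
Hypothesis starx1 : forall x, star x (word [::]) = x.
Hypothesis star_lcons : forall a b x y, star (lcons a x) (lcons b y) =
  lcons a (star x (lcons b y)) + lcons b (star (lcons a x) y)
  + lcons (mul a b) (star x y).
Hypothesis prec1x : forall y, prec (word [::]) y = 0.
Hypothesis prec_lcons : forall a x y, prec (lcons a x) y = lcons a (star x y).
Hypothesis succx1 : forall x, succ x (word [::]) = 0.
Hypothesis succ_lcons : forall b x y, succ x (lcons b y) = lcons b (star x y).
Hypothesis bullet1x : forall y, bullet (word [::]) y = 0.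
Hypothesis bulletx1 : forall x, bullet x (word [::]) = 0.
Hypothesis bullet_lcons : forall a b x y,
  bullet (lcons a x) (lcons b y) = lcons (mul a b) (star x y).

(** Both sides have one term for each nonempty subset of the first letters [a], [b], [c], namely the
    product of the chosen letters followed by the product of what remains. The seven induction
    hypotheses, one per subset, identify the remainders. *)
Lemma star_assoc x y u : star (star x y) u = star x (star y u).
Proof.
move: x y u; apply: (eq_trilinear ext) => [y u|x u|x y|y u|x u|x y|v w z];
  try by move=> c t t'; rewrite !(linearPl, linearPr).
elim: v w z => [|a v IHv] w z; first by rewrite !star1x.
elim: w z => [|b w IHw] z; first by rewrite starx1 star1x.
elim: z => [|c z IHz]; first by rewrite !starx1.
have IHvw := IHv w z; have IHvB := IHv (b :: w) z; have IHvC := IHv w (c :: z).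
have {IHv} IHvBC := IHv (b :: w) (c :: z); have IHwC := IHw (c :: z).
have {IHw} IHwz := IHw z; rewrite -!lconsE in IHvB IHvC IHvBC IHwC IHwz IHz *.
rewrite star_lcons !linearDl /= !star_lcons IHvB IHvC IHvw IHwC IHwz IHvBC.
rewrite !linearDr /= !star_lcons -IHz star_lcons !linearDl mulA.
rewrite !(linearD, linearDr) /=.
(* Terms 1, 2, 3 begin with [a] and terms 4, 7, 10 with [c]: the right side produces the former
   separately and the latter as one product, the left side the other way round. The remaining five
   begin with [ac], [b], [bc], [ab] and [abc]. *)
by rewrite (AC (3*1*1*3*3) ((1*6*9)*(2*(4*7*10)*5)*(3*8*11))).
Qed.

Lemma prec_prec x y u : prec (prec x y) u = prec x (star y u).
Proof.
move: x y u; apply: (eq_trilinear ext) => [y u|x u|x y|y u|x u|x y|[|a v] w z];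
  try by move=> c t t'; rewrite !(linearPl, linearPr).
  by rewrite !prec1x linear0l.
by rewrite -lconsE !prec_lcons star_assoc.
Qed.

(** The leading letter on both sides is that of the middle word; if this word is empty, both sides
    vanish. *)
Lemma succ_prec x y u : prec (succ x y) u = succ x (prec y u).
Proof.
move: x y u; apply: (eq_trilinear ext) => [y u|x u|x y|y u|x u|x y|v [|b w] z];
  try by move=> c t t'; rewrite !(linearPl, linearPr).
  by rewrite prec1x succx1 linear0r linear0l.
by rewrite -lconsE succ_lcons !prec_lcons succ_lcons star_assoc.
Qed.

Lemma star_succ x y u : succ (star x y) u = succ x (succ y u).
Proof.
move: x y u; apply: (eq_trilinear ext) => [y u|x u|x y|y u|x u|x y|v w [|c z]];
  try by move=> c t t'; rewrite !(linearPl, linearPr).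
  by rewrite !succx1 linear0r.
by rewrite -lconsE !succ_lcons star_assoc.
Qed.

(** The first letters of the outer two words merge, the middle word going entirely into the
    remainder. *)
Lemma prec_bullet x y u : bullet (prec x y) u = bullet x (succ y u).
Proof.
move: x y u; apply: (eq_trilinear ext) =>
  [y u|x u|x y|y u|x u|x y|[|a v] w [|c z]];
  try by move=> d t t'; rewrite !(linearPl, linearPr).
- by rewrite succx1 !bulletx1 linear0r.
- by rewrite prec1x bullet1x linear0l.
- by rewrite succx1 bulletx1 linear0r.
by rewrite -!lconsE prec_lcons succ_lcons !bullet_lcons star_assoc.
Qed.

Lemma succ_bullet x y u : bullet (succ x y) u = succ x (bullet y u).
Proof.
move: x y u; apply: (eq_trilinear ext) =>
  [y u|x u|x y|y u|x u|x y|v [|b w] [|c z]];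
  try by move=> d t t'; rewrite !(linearPl, linearPr).
- by rewrite !bulletx1 linear0r.
- by rewrite succx1 bullet1x linear0r linear0l.
- by rewrite !bulletx1 linear0r.
by rewrite -!lconsE succ_lcons !bullet_lcons succ_lcons star_assoc.
Qed.

Lemma bullet_prec x y u : prec (bullet x y) u = bullet x (prec y u).
Proof.
move: x y u; apply: (eq_trilinear ext) =>
  [y u|x u|x y|y u|x u|x y|[|a v] [|b w] z];
  try by move=> d t t'; rewrite !(linearPl, linearPr).
- by rewrite prec1x bullet1x linear0r linear0l.
- by rewrite !bullet1x linear0l.
- by rewrite prec1x bulletx1 linear0r linear0l.
by rewrite -!lconsE !(prec_lcons, bullet_lcons) star_assoc.
Qed.

Lemma bullet_assoc x y u : bullet (bullet x y) u = bullet x (bullet y u).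
Proof.
move: x y u; apply: (eq_trilinear ext) =>
  [y u|x u|x y|y u|x u|x y|[|a v] [|b w] [|c z]];
  try by move=> d t t'; rewrite !(linearPl, linearPr).
all: rewrite ?(bullet1x, bulletx1) ?linear0l ?linear0r ?(bullet1x, bulletx1) //.
by rewrite -!lconsE !bullet_lcons star_assoc mulA.
Qed.

End AbstractQuasiShuffle.

(** * The NQSh identities on T(W) *)

Section Words.
Context {k : fieldType}.
Local Notation TW := {malg k[wordW]}.
Implicit Types (v w z : wordW) (x y u : TW) (a b c : monW).

HB.instance Definition _ a := GRing.Linear.copy (@lprod k a) (linext _).
HB.instance Definition _ := Bilinear.copy (@prec_f k) (bilext _).
HB.instance Definition _ := Bilinear.copy (@succ_f k) (bilext _).
HB.instance Definition _ := Bilinear.copy (@bullet_f k) (bilext _).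

Definition star_f : TW -> TW -> TW := bilext wstar.

HB.instance Definition _ := Bilinear.copy star_f (bilext _).

Lemma lprodU a w : lprod a << w >> = << a :: w >> :> TW.
Proof. exact: linextU. Qed.

Lemma prec_fU v w : prec_f << v >> << w >> = wprec v w :> TW.
Proof. exact: bilextU. Qed.

Lemma succ_fU v w : succ_f << v >> << w >> = wsucc v w :> TW.
Proof. exact: bilextU. Qed.

Lemma bullet_fU v w : bullet_f << v >> << w >> = wbullet v w :> TW.
Proof. exact: bilextU. Qed.

Lemma star_fU v w : star_f << v >> << w >> = wstar v w :> TW.
Proof. exact: bilextU. Qed.

Lemma wstarw0 v : wstar v [::] = << v >> :> TW.
Proof. by case: v. Qed.

(** The last summand is the convention 1 * 1 = 1: the other three vanish at the pair of empty words.
    It corresponds to the last summand of [nqstar]. *)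
Lemma wstar_sum v w :
  wstar v w = wprec v w + wsucc v w + wbullet v w
    + (if nilp v && nilp w then << [::] >> else 0) :> TW.
Proof.
case: v w => [|a v] [|b w]; last by rewrite addr0.
- by rewrite !add0r.
- by rewrite addr0 /wbullet addr0 add0r [RHS]lprodU.
- by rewrite addr0 /wbullet !addr0 /wprec !wstarw0 [RHS]lprodU.
Qed.

Lemma prec_lprod a x y : prec_f (lprod a x) y = lprod a (star_f x y).
Proof.
move: x y; apply: eq_bilinear => [y|x|y|x|v w];
  try by move=> c t t'; rewrite !(linearPl, linearPr, linearP).
by rewrite lprodU prec_fU star_fU.
Qed.

Lemma succ_lprod b x y : succ_f x (lprod b y) = lprod b (star_f x y).
Proof.
move: x y; apply: eq_bilinear => [y|x|y|x|v w];
  try by move=> c t t'; rewrite !(linearPl, linearPr, linearP).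
by rewrite lprodU succ_fU star_fU.
Qed.

Lemma bullet_lprod a b x y :
  bullet_f (lprod a x) (lprod b y) = lprod (monW_mul a b) (star_f x y).
Proof.
move: x y; apply: eq_bilinear => [y|x|y|x|v w];
  try by move=> c t t'; rewrite !(linearPl, linearPr, linearP).
by rewrite !lprodU bullet_fU star_fU.
Qed.

Lemma star_lprod a b x y :
  star_f (lprod a x) (lprod b y) =
    lprod a (star_f x (lprod b y)) + lprod b (star_f (lprod a x) y)
    + lprod (monW_mul a b) (star_f x y).
Proof.
pose g x y := lprod a (star_f x (lprod b y)) + lprod b (star_f (lprod a x) y)
    + lprod (monW_mul a b) (star_f x y).
rewrite -/(g x y); move: x y; apply: eq_bilinear => [y|x|y|x|v w].
- by move=> c t t'; rewrite linearP linearPl.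
- by move=> c t t'; rewrite linearP linearPr.
- move=> c t t'; rewrite /g !(linearPl, linearP) !scalerDr.
  by rewrite (AC (2*2*2) ((1*3*5)*(2*4*6))).
- move=> c t t'; rewrite /g !(linearPr, linearP) !scalerDr.
  by rewrite (AC (2*2*2) ((1*3*5)*(2*4*6))).
by rewrite /g !lprodU !star_fU.
Qed.

Lemma prec_f1x y : prec_f << [::] >> y = 0.
Proof.
move: y; apply: eq_linear => [c u w|c u w|w]; first by rewrite linearPr.
  by rewrite scaler0 addr0.
by rewrite prec_fU.
Qed.

Lemma succ_fx1 x : succ_f x << [::] >> = 0.
Proof.
move: x; apply: eq_linear => [c u w|c u w|w]; first by rewrite linearPl.
  by rewrite scaler0 addr0.
by rewrite succ_fU.
Qed.

Lemma bullet_f1x y : bullet_f << [::] >> y = 0.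
Proof.
move: y; apply: eq_linear => [c u w|c u w|w]; first by rewrite linearPr.
  by rewrite scaler0 addr0.
by rewrite bullet_fU.
Qed.

Lemma bullet_fx1 x : bullet_f x << [::] >> = 0.
Proof.
move: x; apply: eq_linear => [c u w|c u w|w]; first by rewrite linearPl.
  by rewrite scaler0 addr0.
by rewrite bullet_fU; case: w.
Qed.

Lemma star_f1x y : star_f << [::] >> y = y.
Proof.
by move: y; apply: eq_linear => [c u w|//|w]; rewrite ?linearPr ?star_fU.
Qed.

Lemma star_fx1 x : star_f x << [::] >> = x.
Proof.
by move: x; apply: eq_linear => [c u w|//|w];
  rewrite ?linearPl ?star_fU ?wstarw0.
Qed.

Lemma monW_mulA : associative monW_mul.
Proof. by move=> a b c; apply: val_inj; rewrite /= mulmA. Qed.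

Let ext (f g : TW -> TW) (linf : linear f) (ling : linear g)
  (fg : forall w, f << w >> = g << w >>) := eq_linear linf ling fg.

Lemma prec_f_prec x y u : prec_f (prec_f x y) u = prec_f x (star_f y u).
Proof.
exact: (prec_prec monW_mulA (lcons := fun a => @lprod k a) ext lprodU star_f1x
  star_fx1 star_lprod prec_f1x prec_lprod).
Qed.

Lemma succ_f_prec x y u : prec_f (succ_f x y) u = succ_f x (prec_f y u).
Proof.
exact: (succ_prec monW_mulA (lcons := fun a => @lprod k a) ext lprodU star_f1x
  star_fx1 star_lprod prec_f1x prec_lprod succ_fx1 succ_lprod).
Qed.

Lemma star_f_succ x y u : succ_f (star_f x y) u = succ_f x (succ_f y u).
Proof.
exact: (star_succ monW_mulA (lcons := fun a => @lprod k a) ext lprodU star_f1x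
  star_fx1 star_lprod succ_fx1 succ_lprod).
Qed.

Lemma prec_f_bullet x y u : bullet_f (prec_f x y) u = bullet_f x (succ_f y u).
Proof.
exact: (prec_bullet monW_mulA (lcons := fun a => @lprod k a) ext lprodU
  star_f1x star_fx1 star_lprod prec_f1x prec_lprod succ_fx1 succ_lprod
  bullet_f1x bullet_fx1 bullet_lprod).
Qed.

Lemma succ_f_bullet x y u : bullet_f (succ_f x y) u = succ_f x (bullet_f y u).
Proof.
exact: (succ_bullet monW_mulA (lcons := fun a => @lprod k a) ext lprodU
  star_f1x star_fx1 star_lprod succ_fx1 succ_lprod
  bullet_f1x bullet_fx1 bullet_lprod).
Qed.

Lemma bullet_f_prec x y u : prec_f (bullet_f x y) u = bullet_f x (prec_f y u).
Proof.
exact: (bullet_prec monW_mulA (lcons := fun a => @lprod k a) ext lprodU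
  star_f1x star_fx1 star_lprod prec_f1x prec_lprod
  bullet_f1x bullet_fx1 bullet_lprod).
Qed.

Lemma bullet_fA x y u : bullet_f (bullet_f x y) u = bullet_f x (bullet_f y u).
Proof.
exact: (bullet_assoc monW_mulA (lcons := fun a => @lprod k a) ext lprodU
  star_f1x star_fx1 star_lprod bullet_f1x bullet_fx1 bullet_lprod).
Qed.

End Words.

(** * Homogeneity and naturality of the products *)

Section NaturalOperations.
Context {k : fieldType}.
Local Notation TW := {malg k[wordW]}.
Implicit Types (v w : wordW) (x y u : TW) (a b : monW) (m : {cmonom Npos}).
Implicit Type (o : wordW -> wordW -> TW).

Definition wcontent w : {cmonom Npos} := \big[@mmul _/mone]_(a <- w) val a.

(* All the words of u have the same content: since the letters are monomials,
   this is the multidegree of W, which all the products preserve. *)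
Definition homog m u := forall w, w \in msupp u -> wcontent w = m.

Lemma homog0 m : homog m 0.
Proof. by move=> w; rewrite msupp0. Qed.

Lemma homogD m x y : homog m x -> homog m y -> homog m (x + y).
Proof.
move=> hx hy w /(fsubsetP (msuppD_le x y)); rewrite inE.
by case/orP; [exact: hx|exact: hy].
Qed.

Lemma homogZ m (c : k) x : homog m x -> homog m (c *: x).
Proof. by move=> hx w /(fsubsetP (msuppZ_le c x)); exact: hx. Qed.

Lemma homogU w : homog (wcontent w) << w >>.
Proof. by move=> v; rewrite msuppU oner_eq0 inE => /eqP->. Qed.

Lemma homog_linext (B : choiceType) m (f : B -> TW) (t : {malg k[B]}) :
  {in msupp t, forall i, homog m (f i)} -> homog m (linext f t).
Proof.
move=> hf; rewrite /linext big_seq; apply: big_ind; first exact: homog0.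
  by move=> x y; exact: homogD.
by move=> i /hf; exact: homogZ.
Qed.

Lemma homog_lprod m a u : homog m u -> homog (mmul (val a) m) (lprod a u).
Proof.
move=> hu; apply: homog_linext => w /hu <-.
by rewrite -[mmul _ _](big_cons _ _ _ _ xpredT); exact: homogU.
Qed.

Lemma homog_bilext m m' o x y :
  (forall v w, homog (mmul (wcontent v) (wcontent w)) (o v w)) ->
  homog m x -> homog m' y -> homog (mmul m m') (bilext o x y).
Proof.
move=> ho hx hy; rewrite bilextE; apply: homog_linext => v /hx <-.
by apply: homog_linext => w /hy <-; exact: ho.
Qed.

Definition wmap (f : monW -> monW) : TW -> TW := linext (fun w =>
  << map f w >>).

HB.instance Definition _ f := GRing.Linear.copy (wmap f) (linext _).

Lemma wmapU f w : wmap f << w >> = << map f w >>.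
Proof. exact: linextU. Qed.

Lemma wmap_lprod f a u : wmap f (lprod a u) = lprod (f a) (wmap f u).
Proof.
move: u; apply: eq_linear => [c x y|c x y|w].
- by rewrite !linearP.
- by rewrite !linearP.
by rewrite lprodU !wmapU lprodU.
Qed.

(** A quasi-shuffle of [v] and [w] multiplies only a letter of [v] by a letter of [w]. Asking for no
    more is essential: a relabelling respects a product only when the images of the two supports are
    disjoint. *)
Definition letter_morph (f : monW -> monW) v w := {in v & w, forall a b,
  f (monW_mul a b) = monW_mul (f a) (f b)}.

Definition natural_op o :=
  (forall v w, homog (mmul (wcontent v) (wcontent w)) (o v w)) /\
  (forall f v w, letter_morph f v w -> wmap f (o v w) = o (map f v) (map f w)).

Lemma letter_morph_behead f a b v w : letter_morph f (a :: v) (b :: w) ->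
  [/\ f (monW_mul a b) = monW_mul (f a) (f b), letter_morph f v (b :: w),
      letter_morph f (a :: v) w & letter_morph f v w].
Proof.
move=> fM; split; first by apply: fM; rewrite mem_head.
- by move=> c d cv dw; apply: fM; rewrite // inE cv orbT.
- by move=> c d cv dw; apply: fM; rewrite // inE dw orbT.
- by move=> c d cv dw; apply: fM; rewrite inE ?cv ?dw orbT.
Qed.

Lemma wcontent_cons a v : wcontent (a :: v) = mmul (val a) (wcontent v).
Proof. exact: big_cons. Qed.

Lemma wcontent0 : wcontent [::] = mone.
Proof. exact: big_nil. Qed.

Lemma wstar_natural : natural_op wstar.
Proof.
split=> [v w|f v w].
  elim: v w => [|a v IHv] w; first by rewrite wcontent0 mul1m; exact: homogU.
  elim: w => [|b w IHw]; first by rewrite wcontent0 mulm1; exact: homogU.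
  apply: homogD; first apply: homogD.
  - by rewrite wcontent_cons -mulmA; apply/homog_lprod/IHv.
  - by rewrite (wcontent_cons b) Monoid.mulmCA; exact: homog_lprod IHw.
  - have -> : mmul (wcontent (a :: v)) (wcontent (b :: w)) =
        mmul (val (monW_mul a b)) (mmul (wcontent v) (wcontent w)).
      by rewrite !wcontent_cons Monoid.mulmACA.
    by apply/homog_lprod/IHv.
elim: v w => [|a v IHv] w fM; first by rewrite wmapU.
elim: w fM => [|b w IHw] fM; first by rewrite wmapU.
have [fab fMl fMr fMlr] := letter_morph_behead fM.
have wmapE x y u : wmap f (lprod a x + lprod b y + lprod (monW_mul a b) u) =
    lprod (f a) (wmap f x) + lprod (f b) (wmap f y)
    + lprod (monW_mul (f a) (f b)) (wmap f u).
  apply: etrans (linearD (wmap f) _ _) _; apply: congr2.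
    apply: etrans (linearD (wmap f) _ _) _; apply: congr2; exact: wmap_lprod.
  apply: etrans (wmap_lprod f (monW_mul a b) u) _.
  exact: (congr1 (fun c => lprod c (wmap f u)) fab).
apply: etrans (wmapE _ _ _) _.
exact: (congr2 +%R (congr2 +%R (congr1 (lprod _) (IHv _ fMl))
  (congr1 (lprod _) (IHw fMr))) (congr1 (lprod _) (IHv _ fMlr))).
Qed.

Lemma wprec_natural : natural_op wprec.
Proof.
split=> [[|a v] w|f [|a v] w fM]; first exact: homog0.
- by rewrite wcontent_cons -mulmA; apply/homog_lprod/wstar_natural.1.
- exact: linear0.
rewrite [LHS]wmap_lprod wstar_natural.2 // => b c bv; apply: fM.
by rewrite inE bv orbT.
Qed.

Lemma wsucc_natural : natural_op wsucc.
Proof.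
split=> [v [|b w]|f v [|b w] fM]; first exact: homog0.
- by rewrite wcontent_cons Monoid.mulmCA; apply/homog_lprod/wstar_natural.1.
- exact: linear0.
rewrite [LHS]wmap_lprod wstar_natural.2 // => a c av cw; apply: fM => //.
by rewrite inE cw orbT.
Qed.

Lemma wbullet_natural : natural_op wbullet.
Proof.
split=> [[|a v] [|b w]|f [|a v] [|b w] fM]; try exact: homog0.
- have -> : mmul (wcontent (a :: v)) (wcontent (b :: w)) =
      mmul (val (monW_mul a b)) (mmul (wcontent v) (wcontent w)).
    by rewrite !wcontent_cons Monoid.mulmACA.
  by apply/homog_lprod/wstar_natural.1.
- exact: linear0.
- exact: linear0.
- exact: linear0.
have [fab _ _ fMlr] := letter_morph_behead fM.
by rewrite [LHS]wmap_lprod fab wstar_natural.2.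
Qed.

End NaturalOperations.

(** * Standardization *)

Section Standardization.
Local Notation cover := Defs.cover.
Implicit Types (U V : {fset Npos}) (i j : Npos) (f g : Npos -> Npos).
Implicit Types (I J : block) (s : seq block) (n : nat).

Definition incr_on U f := {in U &, forall i j,
  val i < val j -> val (f i) < val (f j)}%N.

Lemma incr_on_inj U f : incr_on U f -> {in U &, injective f}.
Proof.
move=> fU i j iU jU fij; apply/val_inj.
have [/(fU _ _ iU jU)|/(fU _ _ jU iU)|//] := ltngtP (val i) (val j).
  by rewrite fij ltnn.
by rewrite fij ltnn.
Qed.

Lemma ltn_cardfs (T : choiceType) (A B : {fset T}) x :
  A `<=` B -> x \in B -> x \notin A -> (#|` A| < #|` B|)%N.
Proof.
move=> AB xB xNA; apply: fproper_ltn_card; rewrite fproperE AB.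
by apply/fsubsetPn; exists x.
Qed.

Lemma rank_in_incr U : incr_on U (rank_in U).
Proof.
move=> i j iU jU ij; rewrite /= ltnS; apply: (@ltn_cardfs _ _ _ i).
- by apply/fsubsetP => l; rewrite !inE => /andP[-> /ltn_trans]; apply.
- by rewrite !inE iU ij.
- by rewrite !inE ltnn andbF.
Qed.

Lemma rank_in_inj U : {in U &, injective (rank_in U)}.
Proof. exact: incr_on_inj (@rank_in_incr U). Qed.

(** An element of the image lies below [f i] exactly when its preimage lies below [i], so the two
    ranks count equally many elements. *)
Lemma rank_in_imfset U f i : incr_on U f -> i \in U ->
  rank_in (f @` U) (f i) = rank_in U i.
Proof.
move=> fU iU; have fI := incr_on_inj fU; rewrite /rank_in.
have -> : [fset j in f @` U | (val j < val (f i))%N] =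
          f @` [fset j in U | (val j < val i)%N].
  apply/fsetP => l; apply/idP/imfsetP => /= [|[j]].
    rewrite !inE => /andP[/imfsetP[j /= jU ->] lt_fji]; exists j => //.
    rewrite !inE jU /=; have [//|ij|/val_inj ji] := ltngtP (val j) (val i).
      by have := ltn_trans lt_fji (fU _ _ iU jU ij); rewrite ltnn.
    by move: lt_fji; rewrite ji ltnn.
  by rewrite !inE => /andP[jU ij] ->; rewrite in_imfset //= fU.
by rewrite card_in_imfset // => j l; rewrite !inE => /andP[jU _] /andP[lU _];
  exact: fI.
Qed.

Lemma in_cover s i : reflect (exists2 I, I \in s & i \in val I) (i \in cover s).
Proof.
rewrite /cover; apply: (iffP (bigfcupP _ _ _ _)) =>
  [[I /andP[sI _] iI]|[I sI iI]].
  by exists I.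
by exists I => //; rewrite sI.
Qed.

Lemma cover_map f s : cover (map (block_map f) s) = f @` cover s.
Proof.
apply/fsetP => i; apply/in_cover/imfsetP =>
  [[_ /mapP[I sI ->]]|[j /in_cover[I sI jI] ->]].
  by case/imfsetP => j /= jI ->; exists j => //; apply/in_cover; exists I.
by exists (block_map f I); [exact: map_f|rewrite in_imfset].
Qed.

Lemma eq_block_map f g I : {in val I, f =1 g} -> block_map f I = block_map g I.
Proof. by move=> fg; apply/val_inj/eq_in_imfset. Qed.

Lemma block_map_comp f g I : block_map f (block_map g I) = block_map (f \o g) I.
Proof.
apply/val_inj/fsetP => i;
  apply/imfsetP/imfsetP => /= [[_ /imfsetP[j /= jI ->] ->]|].
  by exists j.
by case=> j jI ->; exists (g j); rewrite ?in_imfset.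
Qed.

Lemma eq_map_block f g s : {in cover s, f =1 g} ->
  map (block_map f) s = map (block_map g) s.
Proof.
move=> fg; apply/eq_in_map => I sI; apply: eq_block_map => i iI.
by apply: fg; apply/in_cover; exists I.
Qed.

Lemma map_block_id f s : {in cover s, forall i, f i = i} ->
  map (block_map f) s = s.
Proof.
move=> fs; rewrite (@eq_map_block f id) // -[RHS]map_id; apply: eq_map => I.
by apply: val_inj; rewrite /= imfset_id.
Qed.

Lemma st_blocks_map f s : incr_on (cover s) f ->
  st_blocks (map (block_map f) s) = st_blocks s.
Proof.
move=> fs; rewrite /st_blocks cover_map -map_comp (eq_map (block_map_comp _ _)).
by apply: eq_map_block => i si /=; rewrite rank_in_imfset.
Qed.

Lemma disjoint_blocks_map f s : {in cover s &, injective f} ->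
  disjoint_blocks s -> disjoint_blocks (map (block_map f) s).
Proof.
move=> fI; rewrite /disjoint_blocks pairwise_map.
pose P := [pred I : block | val I `<=` cover s].
have Ps : all P s.
  by apply/allP => I sI; apply/fsubsetP => i iI; apply/in_cover; exists I.
apply: (sub_in_pairwise (P := P)) Ps => I J /fsubsetP Is /fsubsetP Js IJ.
apply/fdisjointP => _ /imfsetP[i /= iI ->]; apply/imfsetP => -[j /= jJ fij].
have ij : i = j by apply: fI => //; [exact: Is|exact: Js].
by have := fdisjointP IJ _ iI; rewrite ij jJ.
Qed.

Definition initial n : {fset Npos} := [fset posS i | i in iota 0 n].

Lemma in_initial n i : (i \in initial n) = (val i <= n)%N.
Proof.
apply/imfsetP/idP => /= [[j]|]; first by rewrite mem_iota => jn ->.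
case: i => [[//|i] i_gt0] /= ltin; exists i; last exact: val_inj.
by rewrite mem_iota.
Qed.

Lemma card_initial n : #|` initial n| = n.
Proof.
rewrite card_imfset /=; last by move=> i j [].
by rewrite undup_id ?size_iota ?iota_uniq.
Qed.

(** The ranks are distinct and at most the size of [U]; by counting, they fill the initial
    segment. *)
Lemma rank_in_image U : rank_in U @` U = initial #|` U|.
Proof.
apply/eqP; rewrite eqEfcard card_initial card_in_imfset;
  last exact: rank_in_inj.
rewrite leqnn andbT; apply/fsubsetP => _ /imfsetP[i /= iU ->].
rewrite in_initial; apply: (@ltn_cardfs _ _ _ i) => //.
  by apply/fsubsetP => j; rewrite !inE => /andP[].
by rewrite !inE ltnn andbF.
Qed.

Lemma cover_st_blocks s : cover (st_blocks s) = initial #|` cover s|.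
Proof. by rewrite cover_map rank_in_image. Qed.

Lemma st_blocks_ordpart s : disjoint_blocks s -> ordpart_pred (st_blocks s).
Proof.
move=> ds; rewrite /ordpart_pred /is_ordpart cover_st_blocks card_initial eqxx.
by rewrite andbT disjoint_blocks_map //; exact: rank_in_inj.
Qed.

Lemma rank_in_initial n i : (val i <= n)%N -> rank_in (initial n) i = i.
Proof.
case: i => [[//|i] i_gt0] /= ltin; apply: val_inj; rewrite /=; congr _.+1.
rewrite -[RHS]card_initial; congr #|` _|; apply/fsetP => j.
rewrite !inE !in_initial /= ltnS andb_idl // => /leq_trans; apply; exact: ltnW.
Qed.

Lemma st_blocks_id n s : cover s = initial n -> st_blocks s = s.
Proof.
move=> sn; rewrite /st_blocks sn map_block_id // => i.
by rewrite sn in_initial => /rank_in_initial.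
Qed.

Lemma rank_inUl U V i : {in U & V, forall i j, val i < val j}%N -> i \in U ->
  rank_in (U `|` V) i = rank_in U i.
Proof.
move=> UV iU; apply: val_inj; congr _.+1; congr #|` _|; apply/fsetP => j.
rewrite !inE; case: (j \in U) => //=; case: (boolP (j \in V)) => //= jV.
by apply/negbTE; rewrite -leqNgt ltnW // UV.
Qed.

Definition shiftp n i : Npos := Sub (val i + n)%N (ltn_addr n (valP i)).

(** All of [U] lies below [i], which raises its rank by the size of [U]. This is where the shift in
    the products of ordered partitions comes from. *)
Lemma rank_inUr U V i : {in U & V, forall i j, val i < val j}%N -> i \in V ->
  rank_in (U `|` V) i = shiftp #|` U| (rank_in V i).
Proof.
move=> UV iV; apply: val_inj; rewrite /= addSn; congr _.+1.
have -> : [fset j in U `|` V | (val j < val i)%N] =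
    [fset j in V | (val j < val i)%N] `|` U.
  apply/fsetP => j; rewrite !inE; case: (boolP (j \in U)) => jU;
    rewrite ?orbT ?orbF //=.
  by rewrite UV.
rewrite cardfsU (_ : _ `&` U = fset0) ?cardfs0 ?subn0 //.
apply/fsetP => j; rewrite !inE; apply/negP => /andP[/andP[jV _] jU].
by have := UV _ _ jU jV; rewrite ltnn.
Qed.

Lemma shiftp_incr n U : incr_on U (shiftp n).
Proof. by move=> i j _ _; rewrite /= ltn_add2r. Qed.

End Standardization.

(** * Squarefree contents, relabellings and separated words *)

Section SquarefreeWords.
Local Notation cover := Defs.cover.
Implicit Types (v w : wordW) (a b : monW) (m : {cmonom Npos}) (s : seq block).
Implicit Types (f g : Npos -> Npos) (i j : Npos).

(* For the content of a word, being squarefree says at once that the letters are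
   of the form x_I and that their blocks are disjoint. *)
Definition sqfree m := forall i, (m i <= 1)%N.

Lemma sqfree_mull m1 m2 : sqfree (mmul m1 m2) -> sqfree m1.
Proof. by move=> sq i; apply: leq_trans (sq i); rewrite cmM leq_addr. Qed.

Lemma sqfree_mulr m1 m2 : sqfree (mmul m1 m2) -> sqfree m2.
Proof. by move=> sq i; apply: leq_trans (sq i); rewrite cmM leq_addl. Qed.

Lemma sqfree_disjoint m1 m2 : sqfree (mmul m1 m2) ->
  [disjoint finsupp m1 & finsupp m2].
Proof.
move=> sq; apply/fdisjointP => i; rewrite -!cmE_neq0 negbK -!lt0n => m1i.
by rewrite -leqn0 -(leq_add2l 1); apply: leq_trans (sq i);
  rewrite cmM leq_add2r.
Qed.

Lemma sqfree_mul m1 m2 : sqfree m1 -> sqfree m2 ->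
  [disjoint finsupp m1 & finsupp m2] -> sqfree (mmul m1 m2).
Proof.
move=> sq1 sq2 /fdisjointP dis i; rewrite cmM.
have := dis i; rewrite -!cmE_neq0 negbK; case: (m1 i =P 0%N) => [-> _|_];
  first exact: sq2.
by move=> /(_ isT)/eqP->; rewrite addn0.
Qed.

Lemma sqfree_x_set (U : {fset Npos}) : sqfree (x_set U).
Proof. by move=> i; rewrite x_setE leq_b1. Qed.

Lemma sqfree_finsupp m : sqfree m -> m = x_set (finsupp m).
Proof.
move=> sq; apply/eqP/cmP => i; rewrite x_setE -cmE_neq0.
by case: (m i) (sq i) => [|[]].
Qed.

Lemma x_setU (U V : {fset Npos}) : [disjoint U & V] ->
  x_set (U `|` V) = mmul (x_set U) (x_set V).
Proof.
move=> /fdisjointP dis; apply/eqP/cmP => i; rewrite cmM !x_setE inE.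
by case: (boolP (i \in U)) => // /dis/negbTE->.
Qed.

Lemma cover_cons (I : block) s : cover (I :: s) = val I `|` cover s.
Proof. by rewrite /cover big_cons. Qed.

Lemma finsupp_wcontent w : finsupp (wcontent w) = cover (map supp w).
Proof.
elim: w => [|a w IHw]; first by rewrite wcontent0 mdom1 /cover big_nil.
by rewrite wcontent_cons mdomD IHw cover_cons.
Qed.

Lemma mem_supp_wcontent w a : a \in w -> val (supp a) `<=` finsupp (wcontent w).
Proof.
move=> aw; rewrite finsupp_wcontent; apply/fsubsetP => i ia.
by apply/in_cover; exists (supp a); rewrite ?map_f.
Qed.

Lemma disjoint_blocks_cons (I : block) s : disjoint_blocks (I :: s) =
  [disjoint val I & cover s]%fset && disjoint_blocks s.
Proof.
rewrite /disjoint_blocks pairwise_cons; congr (_ && _).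
apply/allP/fdisjointP_sym => [dis i /in_cover[J sJ iJ]|dis J sJ].
  by apply: (fdisjointP_sym (dis J sJ)).
by apply/fdisjointP_sym => i iJ; apply: dis; apply/in_cover; exists J.
Qed.

Lemma sqfree_disjoint_blocks w : sqfree (wcontent w) ->
  disjoint_blocks (map supp w).
Proof.
elim: w => // a w IHw; rewrite wcontent_cons => sq.
rewrite -[map _ _]/(supp a :: map supp w) disjoint_blocks_cons.
by rewrite -finsupp_wcontent sqfree_disjoint //= IHw //; exact: sqfree_mulr sq.
Qed.

Lemma sqfree_suppK w : sqfree (wcontent w) -> x_seq (map supp w) = w.
Proof.
elim: w => // a w IHw; rewrite wcontent_cons => sq.
rewrite /= IHw; last exact: sqfree_mulr sq.
by congr (_ :: _); apply: val_inj; rewrite /= -sqfree_finsupp //;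
  apply: sqfree_mull sq.
Qed.

Lemma wcontent_x_seq s : disjoint_blocks s -> wcontent (x_seq s) =
  x_set (cover s).
Proof.
elim: s => [_|I s IHs].
  by apply/eqP/cmP => i; rewrite wcontent0 cm1 x_setE /cover big_nil.
rewrite disjoint_blocks_cons cover_cons => /andP[dis /IHs {}IHs].
by rewrite x_setU // -IHs; exact: (wcontent_cons (x_block I)).
Qed.

(** For a squarefree [a] and [f] injective on its variables, this substitutes [f i] for the index
    [i] of each variable; otherwise multiplicities are lost. *)
Definition relabel f a : monW := x_block (block_map f (supp a)).

Lemma map_relabel f w :
  map (relabel f) w = x_seq (map (block_map f) (map supp w)).
Proof. by rewrite /x_seq -!map_comp. Qed.

Lemma eq_map_relabel f g w : {in finsupp (wcontent w), f =1 g} ->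
  map (relabel f) w = map (relabel g) w.
Proof.
by rewrite finsupp_wcontent => fg; rewrite !map_relabel (eq_map_block fg).
Qed.

Lemma supp_relabel f w :
  map supp (map (relabel f) w) = map (block_map f) (map supp w).
Proof. by rewrite map_relabel /x_seq (mapK x_blockK). Qed.

(** Injectivity on all the variables keeps the disjoint supports of [a] and [b] disjoint after
    relabelling, so that no square appears in the product. *)
Lemma relabel_morph f v w : sqfree (mmul (wcontent v) (wcontent w)) ->
  {in finsupp (mmul (wcontent v) (wcontent w)) &, injective f} ->
  letter_morph (relabel f) v w.
Proof.
move=> sq; rewrite mdomD => fI a b av bw; apply: val_inj => /=.
have av' := fsubsetP (mem_supp_wcontent av).
have bw' := fsubsetP (mem_supp_wcontent bw).
rewrite -x_setU; last first.
  apply/fdisjointP => _ /imfsetP[i /= ia ->]; apply/imfsetP => -[j /= jb fij].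
  have ij : i = j.
    by apply: fI => //; apply/fsetUP; [left; exact: av'|right; exact: bw'].
  by have /fdisjointP/(_ i (av' _ ia)) := sqfree_disjoint sq; rewrite ij bw'.
congr (x_set _); rewrite mdomD; apply/fsetP => i; rewrite inE.
apply/imfsetP/orP => /= [[j]|].
  by rewrite inE => /orP[] jab ->; [left|right]; exact: in_imfset.
by case=> /imfsetP[j /= jab ->]; exists j; rewrite // inE jab ?orbT.
Qed.

(* This is ordpart0 when two letters of w share a variable. *)
Definition std w : ordpart := insubd ordpart0 (st_blocks (map supp w)).

Lemma val_std w : sqfree (wcontent w) -> val (std w) = st_blocks (map supp w).
Proof.
by move=> sq; rewrite val_insubd st_blocks_ordpart ?sqfree_disjoint_blocks.
Qed.

Lemma std_relabel f w : incr_on (finsupp (wcontent w)) f ->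
  std (map (relabel f) w) = std w.
Proof.
by rewrite finsupp_wcontent => fw; rewrite /std supp_relabel st_blocks_map.
Qed.

Lemma x_seq_std w : sqfree (wcontent w) ->
  x_seq (val (std w)) = map (relabel (rank_in (finsupp (wcontent w)))) w.
Proof.
by move=> sq; rewrite val_std // map_relabel finsupp_wcontent.
Qed.

Lemma x_seq_shift n s : x_seq (shift n s) = map (relabel (shiftp n)) (x_seq s).
Proof. by rewrite map_relabel /x_seq (mapK x_blockK). Qed.

Lemma map_relabel_comp f g w :
  map (relabel f) (map (relabel g) w) = map (relabel (f \o g)) w.
Proof.
rewrite [LHS]map_relabel supp_relabel -map_comp [RHS]map_relabel.
by congr x_seq; apply: eq_map => I; exact: block_map_comp.
Qed.

Lemma cover_ordpart (I : ordpart) : cover (val I) = initial (deg I).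
Proof. by have /andP[_ /eqP] := valP I. Qed.

Lemma disjoint_ordpart (I : ordpart) : disjoint_blocks (val I).
Proof. by have /andP[] := valP I. Qed.

Lemma wcontent_ordpart (I : ordpart) :
  wcontent (x_seq (val I)) = x_set (initial (deg I)).
Proof. by rewrite wcontent_x_seq ?disjoint_ordpart // cover_ordpart. Qed.

Lemma std_x_seq (I : ordpart) : std (x_seq (val I)) = I.
Proof.
apply: val_inj; rewrite val_std; last first.
  by rewrite wcontent_ordpart; exact: sqfree_x_set.
by rewrite /x_seq (mapK x_blockK); apply: st_blocks_id (cover_ordpart I).
Qed.

Lemma deg_std w : sqfree (wcontent w) -> deg (std w) =
  #|` finsupp (wcontent w)|.
Proof.
by move=> sq; rewrite /deg val_std // cover_st_blocks card_initial
  finsupp_wcontent.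
Qed.

(** Being expressed through contents, the condition applies to every word of a homogeneous sum at
    once and passes to products of contents. *)
Definition separated m1 m2 := sqfree (mmul m1 m2) /\
  {in finsupp m1 & finsupp m2, forall i j, val i < val j}%N.

(* A single relabelling standardizes v and turns w into its shifted
   standardization. *)
Lemma separated_relabel v w : separated (wcontent v) (wcontent w) ->
  let f := rank_in (finsupp (mmul (wcontent v) (wcontent w))) in
  x_seq (val (std v)) = map (relabel f) v /\
  x_seq (shift (deg (std v)) (val (std w))) = map (relabel f) w.
Proof.
move=> [sq vw] f; have sqv := sqfree_mull sq; have sqw := sqfree_mulr sq.
split.
  rewrite x_seq_std //; apply: eq_map_relabel => i iv.
  by rewrite /f mdomD rank_inUl.
rewrite x_seq_shift x_seq_std // map_relabel_comp;
  apply: eq_map_relabel => i iw.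
by rewrite /f mdomD (rank_inUr vw) // deg_std.
Qed.

Lemma separated_mull m1 m2 m3 : separated m1 m2 -> separated m1 m3 ->
  separated m2 m3 -> separated (mmul m1 m2) m3.
Proof.
move=> [sq12 lt12] [sq13 lt13] [sq23 lt23]; split=> [|i j]; last first.
  by rewrite mdomD => /fsetUP[]; [exact: lt13|exact: lt23].
apply: sqfree_mul => //; first exact: sqfree_mulr sq13.
by rewrite mdomD fdisjointUX !sqfree_disjoint.
Qed.

Lemma separated_mulr m1 m2 m3 : separated m1 m2 -> separated m1 m3 ->
  separated m2 m3 -> separated m1 (mmul m2 m3).
Proof.
move=> [sq12 lt12] [sq13 lt13] [sq23 lt23]; split=> [|i j iU]; last first.
  by rewrite mdomD => /fsetUP[]; [exact: lt12|exact: lt13].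
apply: sqfree_mul => //; first exact: sqfree_mull sq12.
by rewrite mdomD fdisjointXU !sqfree_disjoint.
Qed.

Lemma separated_x_set (U V : {fset Npos}) :
  {in U & V, forall i j, val i < val j}%N -> separated (x_set U) (x_set V).
Proof.
move=> UV; split; last by rewrite !supp_x_set.
apply: sqfree_mul; [exact: sqfree_x_set..|rewrite !supp_x_set].
by apply/fdisjointP => i iU; apply/negP => /(UV _ _ iU); rewrite ltnn.
Qed.

Definition shifted n (I : ordpart) : wordW := x_seq (shift n (val I)).

Lemma std_shifted n (I : ordpart) : std (shifted n I) = I.
Proof.
by rewrite /shifted x_seq_shift std_relabel ?std_x_seq //; exact: shiftp_incr.
Qed.

Lemma wcontent_shifted n (I : ordpart) :
  wcontent (shifted n I) = x_set (shiftp n @` initial (deg I)).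
Proof.
rewrite wcontent_x_seq;
  first by rewrite [shift _ _](erefl (map (block_map (shiftp n)) (val I)))
    cover_map cover_ordpart.
apply: disjoint_blocks_map (disjoint_ordpart I).
exact: incr_on_inj (@shiftp_incr n _).
Qed.

(** The variables of [shifted n1 I] have indices at most [n1 + deg I], those of [shifted n2 J] have
    indices above [n2]. *)
Lemma separated_shifted n1 n2 (I J : ordpart) : (n1 + deg I <= n2)%N ->
  separated (wcontent (shifted n1 I)) (wcontent (shifted n2 J)).
Proof.
move=> le12; rewrite !wcontent_shifted; apply: separated_x_set.
move=> _ _ /imfsetP[i /= iI ->] /imfsetP[j /= jJ ->] /=.
move: iI; rewrite in_initial => iI.
apply: leq_ltn_trans (_ : n2 < _)%N;
  last by rewrite -[ltnLHS]add0n ltn_add2r (valP j).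
by apply: leq_trans le12; rewrite addnC leq_add2l.
Qed.

Lemma shifted0 (I : ordpart) : shifted 0 I = x_seq (val I).
Proof.
rewrite /shifted x_seq_shift map_relabel /x_seq (mapK x_blockK).
by rewrite map_block_id // => i _; apply: val_inj; rewrite /= addn0.
Qed.

End SquarefreeWords.

(** * Operations on ordered partitions *)

Section OrderedPartitions.
Context {k : fieldType}.
Local Notation TW := {malg k[wordW]}.
Local Notation QS := {malg k[ordpart]}.
Implicit Types (v w : wordW) (x y u : TW) (m : {cmonom Npos}) (I J K : ordpart).
Implicit Types (o : wordW -> wordW -> TW) (p q r : QS).

Definition stdl : TW -> QS := linext (fun w => << std w >>).

HB.instance Definition _ := GRing.Linear.copy stdl (linext _).

Lemma stdlU w : stdl << w >> = << std w >>.
Proof. exact: linextU. Qed.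

(** Homogeneity gives all the words of [u] the same variables, so a single [f], increasing on these,
    is invisible to the standardization of each word. *)
Lemma stdl_wmap m f u : homog m u -> incr_on (finsupp m) f ->
  stdl (wmap (relabel f) u) = stdl u.
Proof.
move=> hu fm; apply: (eq_linear_on (f := stdl \o wmap (relabel f))) =>
  [c x y|c x y|w wu].
- by rewrite /= !linearP.
- by rewrite linearP.
rewrite /= wmapU !stdlU; congr << _ >>; apply: std_relabel.
by rewrite (hu _ wu).
Qed.

(** For a natural [o] the words of this product are already standard, and [stdl] only moves it from
    T(W) into [QSh]; see [emb_qop]. Defining [qop] through [stdl] makes it total for every [o]. *)
Definition qop o : QS -> QS -> QS := bilext (fun I J =>
  stdl (o (x_seq (val I)) (shifted (deg I) J))).

HB.instance Definition _ o := Bilinear.copy (qop o) (bilext _).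

Lemma qopU o I J :
  qop o << I >> << J >> = stdl (o (x_seq (val I)) (shifted (deg I) J)).
Proof. exact: bilextU. Qed.

(** One increasing relabelling turns [v] and [w] into the two words used by [qop]. By naturality it
    turns [o v w] into their product, and [stdl] does not see it. *)
Lemma qop_std o v w : natural_op o -> separated (wcontent v) (wcontent w) ->
  qop o << std v >> << std w >> = stdl (o v w).
Proof.
move=> [ho oM] vw; apply: etrans (qopU _ _ _) _.
have [Ev Ew] := separated_relabel vw; rewrite /shifted Ev Ew.
rewrite -oM; first exact/(stdl_wmap (ho v w))/rank_in_incr.
apply: relabel_morph; [exact: vw.1|exact: rank_in_inj].
Qed.

(** An inner product is a sum of words rather than a word; its homogeneity is what allows the
    formula for words to be used a second time. *)
Lemma qop_stdl m1 m2 o x y : natural_op o -> separated m1 m2 ->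
  homog m1 x -> homog m2 y -> qop o (stdl x) (stdl y) = stdl (bilext o x y).
Proof.
move=> on sep hx hy.
apply: (eq_linear_on (f := fun x => qop o (stdl x) (stdl y))
  (g := fun x => stdl (bilext o x y))) => [c s t|c s t|v vx].
- by rewrite linearP linearPl.
- by rewrite linearPl linearP.
apply: (eq_linear_on (f := fun y => qop o (stdl << v >>) (stdl y))
  (g := fun y => stdl (bilext o << v >> y))) => [c s t|c s t|w wy].
- by rewrite linearP linearPr.
- by rewrite linearPr linearP.
apply: etrans (congr1 stdl (esym (bilextU _ _ _))).
apply: etrans (congr2 _ (stdlU _) (stdlU _)) (qop_std on _).
by rewrite (hx _ vx) (hy _ wy).
Qed.

(** The lifts are chosen before the operations, so that the two sides of an axiom, which use
    different operations, are compared on the same triple. *)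
Lemma qop_comp I J K : exists x y u : TW, forall o1 o2,
  natural_op o1 -> natural_op o2 ->
  qop o1 (qop o2 << I >> << J >>) << K >> =
    stdl (bilext o1 (bilext o2 x y) u) /\
  qop o1 << I >> (qop o2 << J >> << K >>) = stdl (bilext o1 x (bilext o2 y u)).
Proof.
(* These offsets place the variables of the three words in consecutive intervals of lengths [deg I],
   [deg J] and [deg K]. *)
pose v := shifted 0 I; pose w := shifted (deg I) J.
pose z := shifted (deg I + deg J) K.
have svw : separated (wcontent v) (wcontent w) by exact: separated_shifted.
have svz : separated (wcontent v) (wcontent z).
  by apply: separated_shifted; rewrite leq_addr.
have swz : separated (wcontent w) (wcontent z) by exact: separated_shifted.
exists << v >>, << w >>, << z >> => o1 o2 on1 on2.
have EI : << I >> = stdl << v >> by rewrite stdlU std_shifted.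
have EJ : << J >> = stdl << w >> by rewrite stdlU std_shifted.
have EK : << K >> = stdl << z >> by rewrite stdlU std_shifted.
have hv := @homogU k v; have hw := @homogU k w; have hz := @homogU k z.
split.
  rewrite EI EJ EK; apply: etrans (congr1 (fun t => qop o1 t _) _) _.
    exact: qop_stdl on2 svw hv hw.
  apply: qop_stdl on1 (separated_mull svw svz swz) _ hz.
  exact: homog_bilext on2.1 hv hw.
rewrite EI EJ EK; apply: etrans (congr1 (qop o1 _) _) _.
  exact: qop_stdl on2 swz hw hz.
apply: qop_stdl on1 (separated_mulr svw svz swz) hv _.
exact: homog_bilext on2.1 hw hz.
Qed.

Lemma qop_axiom o1 o2 o3 o4 : natural_op o1 -> natural_op o2 ->
  natural_op o3 -> natural_op o4 ->
  (forall x y u, bilext o1 (bilext o2 x y) u = bilext o3 x (bilext o4 y u)) ->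
  forall p q r, qop o1 (qop o2 p q) r = qop o3 p (qop o4 q r).
Proof.
move=> on1 on2 on3 on4 E;
  apply: (eq_trilinear (e := fun I : ordpart => << I >> : QS)
  (fun f g linf ling => eq_linear linf ling)
  (f := fun p q r => qop o1 (qop o2 p q) r)
  (g := fun p q r => qop o3 p (qop o4 q r))) => [y u|x u|x y|y u|x u|x y|I J K];
  try by move=> c t t'; rewrite !(linearPl, linearPr).
have [x [y [u H]]] := qop_comp I J K.
apply: etrans (H _ _ on1 on2).1 _; apply: etrans _ (esym (H _ _ on3 on4).2).
by rewrite E.
Qed.

Lemma std_eq0 w : sqfree (wcontent w) -> (std w == ordpart0) = nilp w.
Proof.
move=> sq; rewrite -(inj_eq val_inj) val_std //; by case: w sq.
Qed.

Lemma stdl_coef0 m u : homog m u -> sqfree m -> m != mone ->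
  (stdl u)@_ordpart0 = 0.
Proof.
move=> hu sq m1.
apply: (eq_linear_on (V := k^o) (f := fun u =>
  (stdl u)@_ordpart0) (g := fun=> 0))
  => [c x y|c x y|w wu].
- by rewrite linearP mcoeffD mcoeffZ.
- by rewrite scaler0 addr0.
rewrite stdlU mcoeffU std_eq0 ?(hu _ wu) //.
by case: w wu => // /hu wm; rewrite -wm wcontent0 eqxx in m1.
Qed.

(** The content of a product is a multiple of the content of its first factor, which is not 1 when
    that factor is a nonempty word; hence the empty word does not occur. *)
Lemma qop_closed o p q : natural_op o ->
  in_A ordpart0 p -> in_A ordpart0 (qop o p q).
Proof.
move=> on p0.
apply: (eq_linear_on (V := k^o) (f := fun p =>
  (qop o p q)@_ordpart0) (g := fun=> 0))
  => [c x y|c x y|I Ip].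
- by rewrite linearPl mcoeffD mcoeffZ.
- by rewrite scaler0 addr0.
apply: (eq_linear (V := k^o) (f := fun q =>
  (qop o << I >> q)@_ordpart0) (g := fun=> 0))
  => [c x y|c x y|J].
- by rewrite linearPr mcoeffD mcoeffZ.
- by rewrite scaler0 addr0.
have I0 : I != ordpart0.
  by apply: contraTneq Ip => ->; rewrite -mcoeff_eq0 p0.
have sep : separated (wcontent (shifted 0 I)) (wcontent (shifted (deg I) J)).
  exact: separated_shifted.
rewrite shifted0 in sep; apply: etrans (congr1 (mcoeff _) (qopU _ _ _)) _.
apply: stdl_coef0 (on.1 _ _) sep.1 _; rewrite cmM_eq1 negb_and; apply/orP; left.
apply: contra I0 => /eqP w1; rewrite -val_eqE.
by case: (val I) w1 => // b s; rewrite wcontent_cons => /eqP;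
  rewrite cmM_eq1 (negbTE (valP (x_block b))).
Qed.

End OrderedPartitions.

(** * Coproducts *)

Section Splits.
Context {T : Type}.
Implicit Types (v w : seq T) (a : T).

(** Cuts are enumerated by recursion on the first letter, as in the recursions of the products;
    [splitsE] links this to cuts by position. *)
Fixpoint splits w : seq (seq T * seq T) :=
  match w with
  | [::] => [:: ([::], [::])]
  | a :: w' => ([::], w) :: [seq (a :: p.1, p.2) | p <- splits w']
  end.

Lemma splits_nil : splits [::] = [:: ([::], [::])].
Proof. by []. Qed.

Lemma splits_cons a w :
  splits (a :: w) = ([::], a :: w) :: [seq (a :: p.1, p.2) | p <- splits w].
Proof. by []. Qed.

Lemma splitsE w : splits w = [seq (take i w,
  drop i w) | i <- iota 0 (size w).+1].
Proof.
elim: w => [//|a w IHw]; rewrite splits_cons IHw -map_comp /=.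
by rewrite (iotaDl 2 0) (iotaDl 1 0) -!map_comp.
Qed.

Context {V : nmodType}.

(** Exactly one cut has an empty left part. This evaluates the counit and isolates the terms with
    left tensor factor 1. *)
Lemma sum_splits_nill w (F : seq T * seq T -> V) :
  \sum_(p <- splits w) (if nilp p.1 then F p else 0) = F ([::], w).
Proof.
case: w => [|a w]; first by rewrite splits_nil big_seq1.
by rewrite splits_cons big_cons big_map [X in _ + X]big1 ?addr0.
Qed.

Lemma sum_splits_nilr w (F : seq T * seq T -> V) :
  \sum_(p <- splits w) (if nilp p.2 then F p else 0) = F (w, [::]).
Proof.
elim: w F => [|a w IHw] F; first by rewrite splits_nil big_seq1.
by rewrite splits_cons big_cons big_map add0r (IHw (fun p =>
  F (a :: p.1, p.2))).
Qed.

(** Both sides run over the factorizations of [w] into three consecutive words. *)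
Lemma sum_splitsA w (F : seq T -> seq T -> seq T -> V) :
  \sum_(p <- splits w) \sum_(q <- splits p.1) F q.1 q.2 p.2 =
  \sum_(p <- splits w) \sum_(q <- splits p.2) F p.1 q.1 q.2.
Proof.
elim: w F => [|a w IHw] F; first by rewrite splits_nil !big_seq1 /=.
rewrite splits_cons [in LHS]big_cons [in RHS]big_cons.
rewrite [in LHS]big_map [in RHS]big_map splits_nil big_seq1 splits_cons.
rewrite big_cons big_map -addrA; congr (_ + _).
rewrite -(IHw (fun u => F (a :: u))) -big_split; apply: eq_bigr => p _.
by rewrite splits_cons big_cons big_map.
Qed.

End Splits.

Lemma splits_map (T T' : Type) (f : T -> T') (w : seq T) :
  splits (map f w) = [seq (map f p.1, map f p.2) | p <- splits w].
Proof.
by elim: w => //= a w ->; congr (_ :: _); rewrite -!map_comp.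
Qed.

(** * Deconcatenation of the quasi-shuffle products *)

Section Deconcatenation.
Context {k : fieldType}.
Local Notation TW := {malg k[wordW]}.
Implicit Types (v w : wordW) (x y u : TW) (a b : monW).
Implicit Type (o : wordW -> wordW -> TW).

HB.instance Definition _ := GRing.Linear.copy (@Delta_f k) (linext _).

Lemma Delta_fU w : Delta_f << w >> =
  \sum_(p <- splits w) << p >> :> {malg k[_]}.
Proof.
apply: etrans (linextU _ _) _.
by rewrite -(big_mkord xpredT (fun i =>
  << (take i w, drop i w) >>)) splitsE big_map /index_iota subn0.
Qed.

(** A cut is either made before [a] or keeps [a] at the head of the left part. *)
Lemma Delta_f_lprod a u :
  Delta_f (lprod a u) = tens << [::] >> (lprod a u) + tmap (lprod a) id
    (Delta_f u).
Proof.
move: u; apply: eq_linear => [c x y|c x y|w].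
- by rewrite !linearP.
- have lincomb (V : lmodType k) (s t s' t' : V) :
    c *: s + t + (c *: s' + t') = c *: (s + s') + (t + t').
    by rewrite scalerDr addrACA.
  rewrite (linearP (lprod a)) (linearPr (@tens k _ _)) (linearP (@Delta_f k)).
  by rewrite (linearP (tmap (lprod a) id)); exact: lincomb.
rewrite lprodU !Delta_fU splits_cons big_cons big_map tens11; congr (_ + _).
rewrite linear_sum; apply: eq_bigr => -[w1 w2] _.
by apply: esym; apply: etrans (tmapU _ _ _ _) _; rewrite lprodU tens11.
Qed.

(* For o = wprec, wsucc, wbullet, the term 1 (x) o v w of the coproduct of o v w
   is missing from this sum because o 1 1 = 0. *)
Definition coprod_op o v w := \sum_(p <- splits v) \sum_(q <- splits w)
  tens (o p.1 q.1) (wstar p.2 q.2).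

Lemma coprod_opD o1 o2 v w : coprod_op (fun s t => o1 s t + o2 s t) v w =
  coprod_op o1 v w + coprod_op o2 v w.
Proof.
rewrite /coprod_op -big_split; apply: eq_bigr => p _.
by rewrite -big_split; apply: eq_bigr => q _; exact: linearDl.
Qed.

Lemma coprod_op_nil v w :
  coprod_op (fun s t => if nilp s && nilp t then << [::] >> else 0) v w =
  tens << [::] >> (wstar v w).
Proof.
rewrite -[RHS](sum_splits_nill v (fun p => tens << [::] >> (wstar p.2 w))).
apply: eq_bigr => p _.
pose X (q : wordW * wordW) : {malg k[(wordW * wordW)%type]} :=
  if nilp p.1 then tens << [::] >> (wstar p.2 q.2) else 0.
transitivity (\sum_(q <- splits w) (if nilp q.1 then X q else 0)).
  apply: eq_bigr => q _; rewrite /X; case: (nilp p.1); case: (nilp q.1);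
    first [exact: linear0l|exact: erefl].
apply: etrans (sum_splits_nill w X) _; rewrite /X.
by case: (nilp p.1).
Qed.

(** This is [wstar_sum] applied to the left parts of the cuts; its last summand survives only when
    both are empty, leaving the whole product on the right. *)
Lemma coprod_wstar v w : coprod_op wstar v w =
  coprod_op wprec v w + coprod_op wsucc v w + coprod_op wbullet v w
  + tens << [::] >> (wstar v w).
Proof.
rewrite -coprod_op_nil -!coprod_opD; apply: eq_bigr => p _;
  apply: eq_bigr => q _.
exact: (congr1 (fun t => tens t (wstar p.2 q.2)) (wstar_sum p.1 q.1)).
Qed.

(** Prepending [a] to the left parts turns [wstar p.1 q.1] into [wprec (a :: p.1) q.1], and the cut
    of [a :: v] before [a] contributes 0. Taking the formula for the shorter product as a premise
    makes the lemma usable inside the induction that proves it. *)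
Lemma coprod_wprec_cons a v w :
  Delta_f (wstar v w) = coprod_op wstar v w ->
  Delta_f (wprec (a :: v) w) =
    tens << [::] >> (wprec (a :: v) w) + coprod_op wprec (a :: v) w.
Proof.
move=> E; apply: etrans (Delta_f_lprod _ _) _; rewrite E; congr (_ + _).
rewrite /coprod_op splits_cons big_cons big_map.
rewrite [X in _ = X + _]big1 ?add0r => [|q _]; last exact: linear0l.
rewrite linear_sum; apply: eq_bigr => p _.
rewrite linear_sum; apply: eq_bigr => q _.
by apply: tmap_tens => //; exact: linearP.
Qed.

Lemma coprod_wsucc_cons b v w :
  Delta_f (wstar v w) = coprod_op wstar v w ->
  Delta_f (wsucc v (b :: w)) =
    tens << [::] >> (wsucc v (b :: w)) + coprod_op wsucc v (b :: w).
Proof.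
move=> E; apply: etrans (Delta_f_lprod _ _) _; rewrite E; congr (_ + _).
rewrite linear_sum; apply: eq_bigr => p _; rewrite splits_cons big_cons big_map.
rewrite [X in _ = X + _](_ : _ = 0) ?add0r; last exact: linear0l.
rewrite linear_sum; apply: eq_bigr => q _.
by apply: tmap_tens => //; exact: linearP.
Qed.

Lemma coprod_wbullet_cons a b v w :
  Delta_f (wstar v w) = coprod_op wstar v w ->
  Delta_f (wbullet (a :: v) (b :: w)) =
    tens << [::] >> (wbullet (a :: v) (b :: w))
    + coprod_op wbullet (a :: v) (b :: w).
Proof.
move=> E; apply: etrans (Delta_f_lprod _ _) _; rewrite E; congr (_ + _).
rewrite /coprod_op splits_cons big_cons big_map.
rewrite [X in _ = X + _]big1 ?add0r => [|q _]; last exact: linear0l.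
rewrite linear_sum; apply: eq_bigr => p _; rewrite splits_cons big_cons big_map.
rewrite [X in _ = X + _](_ : _ = 0) ?add0r; last exact: linear0l.
rewrite linear_sum; apply: eq_bigr => q _.
by apply: tmap_tens => //; exact: linearP.
Qed.

Lemma Delta_wstar v w : Delta_f (wstar v w) = coprod_op wstar v w.
Proof.
elim: v w => [|a v IHv] w.
  rewrite /coprod_op splits_nil big_seq1; apply: etrans (Delta_fU _) _.
  by apply: eq_bigr => -[w1 w2] _; exact: esym (tens11 _ _ _).
elim: w => [|b w IHw].
  apply: etrans (Delta_fU _) _; apply: eq_bigr => -[w1 w2] _.
  rewrite splits_nil big_seq1; apply: etrans (esym (tens11 _ _ _)) _.
  exact: congr2 (esym (wstarw0 _)) (esym (wstarw0 _)).
apply: etrans _ (esym (coprod_wstar _ _)).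
have := coprod_wprec_cons a (IHv (b :: w)).
have := coprod_wsucc_cons b IHw; have := coprod_wbullet_cons a b (IHv w).
(* The three terms with left factor 1 are collected into the one of the whole star product, as
   [coprod_wstar] requires. *)
have sum3 x y u X Y Z : Delta_f u = tens << [::] >> u + Z ->
    Delta_f y = tens << [::] >> y + Y -> Delta_f x = tens << [::] >> x + X ->
    Delta_f (x + y + u) = X + Y + Z + tens << [::] >> (x + y + u).
  have sumE (V : zmodType) (s1 s2 s3 t1 t2 t3 : V) :
      s1 + t1 + (s2 + t2) + (s3 + t3) = t1 + t2 + t3 + (s1 + s2 + s3).
    by rewrite (AC (2*2*2) ((2*4*6)*(1*3*5))).
  move=> Eu Ey Ex; rewrite (linearD (@Delta_f k)) /= (linearD (@Delta_f k)) /=.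
  rewrite Ex Ey Eu; apply: etrans (sumE _ _ _ _ _ _ _) (congr1 (+%R _) _).
  by rewrite (linearDr (@tens k _ _)) (linearDr (@tens k _ _)).
exact: sum3.
Qed.

Lemma Delta_wprec v w :
  Delta_f (wprec v w) = tens << [::] >> (wprec v w) + coprod_op wprec v w.
Proof.
case: v => [|a v]; last exact/coprod_wprec_cons/Delta_wstar.
rewrite /coprod_op splits_nil big_seq1 big1 => [|q _]; last exact: linear0l.
by rewrite linear0 linear0r addr0.
Qed.

Lemma Delta_wsucc v w :
  Delta_f (wsucc v w) = tens << [::] >> (wsucc v w) + coprod_op wsucc v w.
Proof.
case: w => [|b w]; last exact/coprod_wsucc_cons/Delta_wstar.
rewrite /coprod_op [X in _ + X]big1 => [|p _].
  by rewrite linear0 linear0r addr0.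
rewrite splits_nil big_seq1; exact: linear0l.
Qed.

Lemma Delta_wbullet v w :
  Delta_f (wbullet v w) = tens << [::] >> (wbullet v w) + coprod_op wbullet v w.
Proof.
case: v => [|a v].
  rewrite /coprod_op splits_nil big_seq1 big1 => [|q _]; last exact: linear0l.
  by rewrite linear0 linear0r addr0.
case: w => [|b w]; last exact/coprod_wbullet_cons/Delta_wstar.
rewrite /coprod_op [X in _ + X]big1 => [|p _].
  by rewrite linear0 linear0r addr0.
rewrite splits_nil big_seq1 /wbullet; case: p.1 => *; exact: linear0l.
Qed.

End Deconcatenation.

(** * The coproduct of ordered partitions *)

Section Coproduct.
Context {k : fieldType}.
Local Notation TW := {malg k[wordW]}.
Local Notation QS := {malg k[ordpart]}.
Local Notation QQ := {malg k[(ordpart * ordpart)%type]}.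
Implicit Types (v w : wordW) (x y u : TW) (m : {cmonom Npos}) (I J K : ordpart).
Implicit Types (o : wordW -> wordW -> TW) (p q r : QS).

HB.instance Definition _ := GRing.Linear.copy (@emb k) (linext _).

Definition qDelta p : QQ := tmap stdl stdl (Delta_f (emb p)).

Lemma qDelta_linear : linear qDelta.
Proof. by move=> c p q; rewrite /qDelta !linearP. Qed.

HB.instance Definition _ := GRing.isLinear.Build k QS QQ *:%R qDelta
  qDelta_linear.

Lemma tmap_stdlU (s : wordW * wordW) :
  tmap stdl stdl << s >> = << (std s.1, std s.2) >> :> QQ.
Proof.
case: s => v w; apply: etrans (tmapU _ _ _ _) _.
exact: etrans (congr2 tens (stdlU _) (stdlU _)) (tens11 _ _ _).
Qed.

Lemma splits_content (s : wordW * wordW) w : s \in splits w ->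
  wcontent w = mmul (wcontent s.1) (wcontent s.2).
Proof.
rewrite splitsE => /mapP[i _ ->] /=.
by rewrite -{1}(cat_take_drop i w) /wcontent big_cat.
Qed.

Lemma incr_onS (U V : {fset Npos}) f : U `<=` V -> incr_on V f -> incr_on U f.
Proof. by move=> /fsubsetP UV fV i j iU jU; apply: fV; exact: UV. Qed.

(** Ranks among the variables of [w] increase along those of each part, hence disappear once the
    part is standardized: standardizing before the cut changes nothing. Any squarefree lift may thus
    be used to compute the coproduct. *)
Lemma qDelta_std w : sqfree (wcontent w) ->
  qDelta << std w >> = \sum_(s <- splits w) << (std s.1, std s.2) >>.
Proof.
move=> sq; rewrite /qDelta emb1 x_seq_std // Delta_fU splits_map big_map
  linear_sum.
apply: eq_big_seq => s sw; apply: etrans (tmap_stdlU _) _ => /=.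
have sub1 : finsupp (wcontent s.1) `<=` finsupp (wcontent w).
  by rewrite (splits_content sw) mdomD fsubsetUl.
have sub2 : finsupp (wcontent s.2) `<=` finsupp (wcontent w).
  by rewrite (splits_content sw) mdomD fsubsetUr.
by rewrite !std_relabel //; apply: incr_onS (@rank_in_incr _).
Qed.

Lemma qDeltaU I :
  qDelta << I >> = \sum_(s <- splits (x_seq (val I))) << (std s.1, std s.2) >>.
Proof.
rewrite -qDelta_std ?std_x_seq //.
by rewrite wcontent_ordpart; exact: sqfree_x_set.
Qed.

Lemma qDelta_stdl m u : homog m u -> sqfree m ->
  qDelta (stdl u) = tmap stdl stdl (Delta_f u).
Proof.
move=> hu sq; apply: (eq_linear_on (f := qDelta \o stdl)
  (g := tmap stdl stdl \o (@Delta_f k))) => [c x y|c x y|w wu].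
- by rewrite /= !linearP.
- by rewrite /= !linearP.
rewrite /= stdlU qDelta_std ?(hu _ wu) // Delta_fU linear_sum.
by apply: eq_bigr => s _; exact: esym (tmap_stdlU _).
Qed.

Lemma separated_mul m1 m2 m3 m4 : separated (mmul m1 m2) (mmul m3 m4) ->
  separated m1 m3 /\ separated m2 m4.
Proof.
move=> [sq lt]; split; split.
- by move: sq; rewrite Monoid.mulmACA => /sqfree_mull.
- by move=> i j im jm; apply: lt; rewrite mdomD; apply/fsetUP; left.
- by move: sq; rewrite Monoid.mulmACA => /sqfree_mulr.
- by move=> i j im jm; apply: lt; rewrite mdomD; apply/fsetUP; right.
Qed.

Lemma std0 : std [::] = ordpart0.
Proof. by apply/eqP; rewrite std_eq0 // => i; rewrite wcontent0 cm1. Qed.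

(** On separated lifts, the left parts of two cuts are again separated, and so are the right parts;
    [qop_std] then applies in each tensor factor. *)
Lemma qDelta_qop o p q : natural_op o ->
  (forall v w, Delta_f (o v w) = tens << [::] >> (o v w) + coprod_op o v w) ->
  qDelta (qop o p q) = tens << ordpart0 >> (qop o p q)
    + tmap2 (qop o) (qop wstar) (qDelta p) (qDelta q).
Proof.
move=> on oD.
have lincomb (V : lmodType k) c (s t s' t' : V) :
    c *: s + t + (c *: s' + t') = c *: (s + s') + (t + t').
  by rewrite scalerDr addrACA.
pose F p q := tens << ordpart0 >> (qop o p q)
    + tmap2 (qop o) (qop wstar) (qDelta p) (qDelta q).
rewrite -/(F p q).
move: p q; apply: (eq_bilinear (f := fun p q =>
  qDelta (qop o p q)) (g := F)) => [q|p|q|p|I J].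
- by move=> c s t; rewrite linearPl linearP.
- by move=> c s t; rewrite linearPr linearP.
- move=> c s t; rewrite /F (linearPl (qop o)) (linearPr (@tens k _ _)).
  rewrite (linearP qDelta) (linearPl (tmap2 _ _)); exact: lincomb.
- move=> c s t; rewrite /F (linearPr (qop o)) (linearPr (@tens k _ _)).
  rewrite (linearP qDelta) (linearPr (tmap2 _ _)); exact: lincomb.
pose v := shifted 0 I; pose w := shifted (deg I) J.
have sep : separated (wcontent v) (wcontent w) by exact: separated_shifted.
have Eop : qop o << I >> << J >> = stdl (o v w).
  by rewrite -(qop_std on sep) !std_shifted.
rewrite /F Eop (qDelta_stdl (on.1 v w) sep.1) oD linearD; congr (_ + _).
  apply: etrans (tmap_tens _ _ _ _) _; [exact: linearP..|].
  by rewrite stdlU std0.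
have EI : qDelta << I >> = \sum_(s <- splits v) << (std s.1, std s.2) >>.
  by rewrite -qDelta_std ?std_shifted //; exact: sqfree_mull sep.1.
have EJ : qDelta << J >> = \sum_(s <- splits w) << (std s.1, std s.2) >>.
  by rewrite -qDelta_std ?std_shifted //; exact: sqfree_mulr sep.1.
apply: etrans _ (esym (congr2 (tmap2 (qop o) (qop wstar)) EI EJ)).
rewrite linear_sumlz linear_sum; apply: eq_big_seq => s sv.
rewrite linear_sumr linear_sum; apply: eq_big_seq => t tw.
have [sep1 sep2] : separated (wcontent s.1) (wcontent t.1) /\
    separated (wcontent s.2) (wcontent t.2).
  by apply: separated_mul; rewrite -(splits_content sv) -(splits_content tw).
apply: etrans (tmap_tens _ _ _ _) _; [exact: linearP..|].
have E1 := qop_std on sep1; have E2 := qop_std (@wstar_natural k) sep2.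
apply: etrans (congr2 tens (esym E1) (esym E2)) _.
exact: esym (tmap2U _ _ (std s.1, std s.2) (std t.1, std t.2)).
Qed.

(** Both iterated coproducts standardize the three parts of a double cut, each part having a
    squarefree content. *)
Lemma qDelta_coassociative : coassociative qDelta.
Proof.
apply: eq_linear => [c p q|c p q|I]; rewrite ?linearP //.
rewrite /= qDeltaU; pose v := x_seq (val I).
have sq : sqfree (wcontent v) by rewrite wcontent_ordpart; exact: sqfree_x_set.
pose F (a b c : wordW) : {malg k[(ordpart * (ordpart * ordpart))%type]} :=
  << (std a, (std b, std c)) >>.
transitivity (\sum_(s <- splits v) \sum_(t <- splits s.1) F t.1 t.2 s.2).
  rewrite (linear_sum (tmap qDelta id)) (linear_sum tassoc) /=.
  apply: eq_big_seq => s sv; rewrite tmapU qDelta_std; last first.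
    by apply: (@sqfree_mull _ (wcontent s.2)); rewrite -(splits_content sv).
  rewrite linear_sumlz (linear_sum tassoc) /=; apply: eq_bigr => t _.
  by rewrite tens11; exact: linextU.
rewrite sum_splitsA (linear_sum (tmap id qDelta)) /=.
apply: eq_big_seq => s sv.
rewrite tmapU qDelta_std; last first.
  by apply: (@sqfree_mulr (wcontent s.1)); rewrite -(splits_content sv).
by rewrite linear_sumr /=; apply: eq_bigr => t _; rewrite tens11.
Qed.

(** The counit is the coefficient of the empty partition, and only the cut with an empty left part
    standardizes to it on the left. *)
Lemma qDelta_counit_l p : counit_l (mcoeff ordpart0) (qDelta p) = p.
Proof.
move: p; apply: (eq_linear (f := fun p => counit_l (mcoeff ordpart0) (qDelta p))
  (g := id)) => [c p q|//|I]; first by rewrite (linearP qDelta) linearP.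
rewrite qDeltaU linear_sum /=; set v := x_seq (val I).
have sq : sqfree (wcontent v) by rewrite wcontent_ordpart; exact: sqfree_x_set.
transitivity (\sum_(s <- splits v) (if nilp s.1 then << std s.2 >> else 0) :
  QS).
  apply: eq_big_seq => s sv; apply: etrans (linextU _ _) _.
  rewrite mcoeffU std_eq0; last first.
    by apply: (@sqfree_mull _ (wcontent s.2)); rewrite -(splits_content sv).
  by case: nilp; rewrite ?scale1r ?scale0r.
rewrite (sum_splits_nill v (fun s => << std s.2 >> : QS)).
by rewrite std_x_seq.
Qed.

Lemma qDelta_counit_r p : counit_r (mcoeff ordpart0) (qDelta p) = p.
Proof.
move: p; apply: (eq_linear (f := fun p => counit_r (mcoeff ordpart0) (qDelta p))
  (g := id)) => [c p q|//|I]; first by rewrite (linearP qDelta) linearP.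
rewrite qDeltaU linear_sum /=; set v := x_seq (val I).
have sq : sqfree (wcontent v) by rewrite wcontent_ordpart; exact: sqfree_x_set.
transitivity (\sum_(s <- splits v) (if nilp s.2 then << std s.1 >> else 0) :
  QS).
  apply: eq_big_seq => s sv; apply: etrans (linextU _ _) _.
  rewrite mcoeffU std_eq0; last first.
    by apply: (@sqfree_mulr (wcontent s.1)); rewrite -(splits_content sv).
  by case: nilp; rewrite ?scale1r ?scale0r.
rewrite (sum_splits_nilr v (fun s => << std s.1 >> : QS)).
by rewrite std_x_seq.
Qed.

Lemma qDelta1 : qDelta << ordpart0 >> = << (ordpart0, ordpart0) >>.
Proof. by rewrite qDeltaU big_seq1 std0. Qed.

End Coproduct.

(** * The reduced coproduct of a product *)

Section ReducedCoproduct.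
Context {k : fieldType} {B : choiceType} (e : B).
Local Notation H := {malg k[B]}.
Local Notation HH := {malg k[(B * B)%type]}.
Implicit Types (x y : H) (t : HH).

(** The unit laws for an operation hold on [A] only; this makes them applicable to both components
    of every basis pair in a reduced coproduct. *)
Lemma in_AA_supp t (p : B * B) : in_AA e t -> p \in msupp t ->
  in_A e (<< p.1 >> : H) /\ in_A e (<< p.2 >> : H).
Proof.
case: p => b c tA; rewrite -mcoeff_neq0 => tbc; rewrite /in_A !mcoeffU.
suff : ~~ ((b == e) || (c == e)) by case/norP => /negbTE-> /negbTE->.
by apply: contra tbc => bc; rewrite tA.
Qed.

Lemma tmap_in_AAl (f : H -> H) (g : H -> H) t : in_AA e t ->
  (forall x, in_A e x -> f x = x) -> tmap f g t = tmap id g t.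
Proof.
by move=> tA fA; apply: eq_tmap_on => // p /(in_AA_supp tA)[pA _]; exact: fA.
Qed.

Lemma tmap_in_AA0 (f : H -> H) (g : H -> H) t : in_AA e t ->
  (forall x, in_A e x -> f x = 0) -> tmap f g t = 0.
Proof.
move=> tA fA; apply: etrans (_ : tmap (fun=> 0) g t = 0).
  by apply: eq_tmap_on => // p /(in_AA_supp tA)[pA _]; exact: fA.
by apply: big1 => p _; rewrite linear0l scaler0.
Qed.

Lemma tmap_idr (f g : H -> H) t : (forall x, g x = x) ->
  tmap f g t = tmap f id t.
Proof. by move=> gE; apply: eq_tmap_on. Qed.

Lemma redcoprodE (Delta : H -> HH) x :
  Delta x = redcoprod e Delta x + tens x << e >> + tens << e >> x.
Proof. by rewrite /redcoprod addrAC !subrK. Qed.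

(** The variables [x], [y], [z] and their primed versions stand for the reduced part and the two
    unit parts of a coproduct. Of the nine products, [s5] together with [u] is what the reduced
    coproduct of the product removes, and the ninth vanishes by [op 1 1 = 0]. *)
Lemma bilinear_sum3 (V1 V2 V : lmodType k) (F : {bilinear V1 -> V2 -> V})
    (x y z : V1) (x' y' z' : V2) (u s1 s2 s3 s4 s5 s6 s7 s8 : V) :
  F x x' = s1 -> F x y' = s2 -> F x z' = s3 -> F y x' = s4 -> F y y' = s5 ->
  F y z' = s6 -> F z x' = s7 -> F z y' = s8 -> F z z' = 0 ->
  u + F (x + y + z) (x' + y' + z') - s5 - u =
    s1 + s3 + s4 + s2 + s7 + s6 + s8.
Proof.
move=> E1 E2 E3 E4 E5 E6 E7 E8 E9; rewrite !linearDl !linearDr /=.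
rewrite E1 E2 E3 E4 E5 E6 E7 E8 E9 addr0 addrAC [u + _]addrC addrK.
by rewrite [X in X - _](AC (3*3*2) ((1*3*4*2*7*6*8)*5)) addrK.
Qed.

(** A common source of the three compatibility axioms: the terms containing [op x 1] or [op 1 y],
    inside or outside a reduced coproduct, survive or vanish according to the unit laws of the
    operation. *)
Lemma redcoprod_op (op star : H -> H -> H) (Delta : H -> HH) x y :
  bilinear_for *:%R *:%R op -> bilinear_for *:%R *:%R star ->
  (forall x, star << e >> x = x) -> (forall x, star x << e >> = x) ->
  op << e >> << e >> = 0 ->
  Delta (op x y) = tens << e >> (op x y) + tmap2 op star (Delta x) (Delta y) ->
  let T := redcoprod e Delta in
  T (op x y) = tmap2 op star (T x) (T y)
    + tmap (op^~ << e >>) (star^~ y) (T x) + tmap (op x) id (T y)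
    + tmap (op^~ y) id (T x) + tmap (op << e >>) (star x) (T y)
    + tens (op x << e >>) y + tens (op << e >> y) x.
Proof.
move=> opb starb star1x starx1 op11 DE T.
have idr (f : H -> H) t : tmap f (star^~ << e >>) t = tmap f id t.
  exact: tmap_idr starx1.
have idl (f : H -> H) t : tmap f (star << e >>) t = tmap f id t.
  exact: tmap_idr star1x.
have D2 := etrans DE (congr2 (fun s t =>
  tens << e >> (op x y) + tmap2 op star s t)
  (redcoprodE Delta x) (redcoprodE Delta y)).
apply: etrans (congr1 (fun t =>
  t - tens (op x y) << e >> - tens << e >> (op x y)) D2) _.
apply: bilinear_sum3.
- exact: erefl.
- exact: etrans (tmap2_tensr _ _ _ opb starb) (idr _ _).
- exact: tmap2_tensr.
- exact: etrans (tmap2_tensl _ _ _ opb starb) (idl _ _).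
- exact: etrans (tmap2_tens _ _ _ _ opb starb) (congr1 _ (starx1 _)).
- exact: etrans (tmap2_tens _ _ _ _ opb starb) (congr1 _ (star1x _)).
- exact: tmap2_tensl.
- exact: etrans (tmap2_tens _ _ _ _ opb starb) (congr1 _ (starx1 _)).
apply: etrans (tmap2_tens _ _ _ _ opb starb) _; rewrite op11; exact: linear0l.
Qed.

Lemma nqstar_bilinear (prec succ bullet : {bilinear H -> H -> H}) :
  bilinear_for *:%R *:%R (nqstar e prec succ bullet).
Proof.
have sum4 (c : k) (x1 x2 x3 x4 y1 y2 y3 y4 : H) :
    c *: x1 + y1 + (c *: x2 + y2) + (c *: x3 + y3) + (c *: x4 + y4) =
    c *: (x1 + x2 + x3 + x4) + (y1 + y2 + y3 + y4).
  by rewrite !scalerDr (AC (2*2*2*2) ((1*3*5*7)*(2*4*6*8))).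
have scaleP (c a b : k) : (c * a + b) *: << e >> =
  c *: (a *: << e >>) + b *: << e >> :> H.
  by rewrite scalerDl scalerA.
split=> [y|x] c s t; rewrite /nqstar.
  rewrite (linearPl prec) (linearPl succ) (linearPl bullet) /=.
  rewrite mcoeffD mcoeffZ mulrDl -mulrA.
  exact: etrans (congr1 (+%R _) (scaleP _ _ _)) (sum4 _ _ _ _ _ _ _ _ _).
rewrite (linearPr prec) (linearPr succ) (linearPr bullet) /=.
rewrite mcoeffD mcoeffZ mulrDr mulrCA.
exact: etrans (congr1 (+%R _) (scaleP _ _ _)) (sum4 _ _ _ _ _ _ _ _ _).
Qed.

End ReducedCoproduct.

(** * The NQSh bialgebra of ordered partitions *)

Section Bialgebra.
Context {k : fieldType}.
Local Notation TW := {malg k[wordW]}.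
Local Notation QS := {malg k[ordpart]}.
Local Notation unit := ordpart0.
Implicit Types (v w : wordW) (I J : ordpart) (p q r : QS).

Local Notation qprec := (@qop k wprec).
Local Notation qsucc := (@qop k wsucc).
Local Notation qbullet := (@qop k wbullet).
Local Notation qstar := (@qop k wstar).

Lemma qop_bilinear o : bilinear_for *:%R *:%R (@qop k o).
Proof. exact: bilext_bilinear. Qed.

Lemma stdl_x_seq I : stdl << x_seq (val I) >> = << I >> :> QS.
Proof. by rewrite stdlU std_x_seq. Qed.

Lemma stdl_shifted n I : stdl << shifted n I >> = << I >> :> QS.
Proof. by rewrite stdlU std_shifted. Qed.

Lemma nilp_x_seq I : nilp (x_seq (val I)) = (I == unit).
Proof. by rewrite -val_eqE; case: (val I). Qed.

Lemma nilp_shifted n I : nilp (shifted n I) = (I == unit).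
Proof. by rewrite -val_eqE /shifted; case: (val I). Qed.

Lemma wprecw0 v : ~~ nilp v -> wprec v [::] = << v >> :> TW.
Proof.
by case: v => // a v _;
  exact: etrans (congr1 (lprod a) (wstarw0 v)) (lprodU a v).
Qed.

Lemma wsucc0w w : ~~ nilp w -> wsucc [::] w = << w >> :> TW.
Proof. by case: w => // b w _; exact: lprodU. Qed.

Lemma qprec1x p : qprec << unit >> p = 0.
Proof.
move: p; apply: (eq_linear (f := qprec << unit >>) (g := fun=> 0)) =>
  [c p q|c p q|J].
- by rewrite linearPr.
- by rewrite scaler0 addr0.
by apply: etrans (qopU _ _ _) _; exact: linear0.
Qed.

Lemma qsuccx1 p : qsucc p << unit >> = 0.
Proof.
move: p; apply: (eq_linear (f := qsucc^~ << unit >>) (g := fun=> 0)) =>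
  [c p q|c p q|J].
- by rewrite linearPl.
- by rewrite scaler0 addr0.
by apply: etrans (qopU _ _ _) _; exact: linear0.
Qed.

Lemma qbullet1x p : qbullet << unit >> p = 0.
Proof.
move: p; apply: (eq_linear (f := qbullet << unit >>) (g := fun=> 0)) =>
  [c p q|c p q|J].
- by rewrite linearPr.
- by rewrite scaler0 addr0.
by apply: etrans (qopU _ _ _) _; exact: linear0.
Qed.

Lemma qbulletx1 p : qbullet p << unit >> = 0.
Proof.
move: p; apply: (eq_linear (f := qbullet^~ << unit >>) (g := fun=> 0)) =>
  [c p q|c p q|J].
- by rewrite linearPl.
- by rewrite scaler0 addr0.
apply: etrans (qopU _ _ _) _; apply: etrans (congr1 stdl _) (linear0 stdl).
by rewrite /shifted /=; case: (x_seq _).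
Qed.

Lemma in_A_supp p I : in_A unit p -> I \in msupp p -> I != unit.
Proof. by move=> p0; rewrite -mcoeff_neq0; apply: contraNneq => ->;
  rewrite p0. Qed.

Lemma qprecx1 p : in_A unit p -> qprec p << unit >> = p.
Proof.
move=> pA; apply: (eq_linear_on (f := qprec^~ << unit >>) (g := id)) =>
  [c s t|//|I Ip].
  by rewrite linearPl.
apply: etrans (qopU _ _ _) _;
  apply: etrans (congr1 stdl (wprecw0 _)) (stdl_x_seq _).
by rewrite nilp_x_seq (in_A_supp pA).
Qed.

Lemma qsucc1x p : in_A unit p -> qsucc << unit >> p = p.
Proof.
move=> pA; apply: (eq_linear_on (f := qsucc << unit >>) (g := id)) =>
  [c s t|//|I Ip].
  by rewrite linearPr.
apply: etrans (qopU _ _ _) _;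
  apply: etrans (congr1 stdl (wsucc0w _)) (stdl_shifted _ _).
by rewrite nilp_shifted (in_A_supp pA).
Qed.

Lemma qstar1x p : qstar << unit >> p = p.
Proof.
move: p; apply: (eq_linear (f := qstar << unit >>) (g := id)) => [c s t|//|I].
  by rewrite linearPr.
by apply: etrans (qopU _ _ _) _; exact: stdl_shifted.
Qed.

Lemma qstarx1 p : qstar p << unit >> = p.
Proof.
move: p; apply: (eq_linear (f := qstar^~ << unit >>) (g := id)) => [c s t|//|I].
  by rewrite linearPl.
apply: etrans (qopU _ _ _) _.
exact: etrans (congr1 stdl (wstarw0 _)) (stdl_x_seq _).
Qed.

Lemma nqstarE p q : nqstar unit qprec qsucc qbullet p q = qstar p q.
Proof.
move: p q; apply: (eq_bilinear (f := nqstar unit qprec qsucc qbullet) (g :=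
  qstar))
  => [q|p|q|p|I J].
- exact: (nqstar_bilinear unit qprec qsucc qbullet).1.
- exact: (nqstar_bilinear unit qprec qsucc qbullet).2.
- by move=> c s t; rewrite linearPl.
- by move=> c s t; rewrite linearPr.
apply: esym; apply: etrans (qopU _ _ _) _.
apply: etrans (congr1 stdl (wstar_sum _ _)) _.
have sum4 (x y z t : TW) : stdl (x + y + z + t) =
  stdl x + stdl y + stdl z + stdl t.
  by rewrite !linearD.
apply: etrans (sum4 _ _ _ _) _; apply: congr2.
  by apply: congr2; [apply: congr2|]; exact: esym (qopU _ _ _).
apply: etrans _ (congr1 (fun c => c *: << unit >>)
  (esym (congr2 *%R (mcoeffU _ _ _) (mcoeffU _ _ _)))).
(* A lifted word is empty exactly when its partition is the unit, so the corrective summands of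
   [wstar_sum] and [nqstar] agree in all four cases. *)
rewrite nilp_x_seq nilp_shifted; case: (I == unit); case: (J == unit).
- by apply: etrans (stdlU _) _; rewrite std0 mulr1 scale1r.
- by apply: etrans (linear0 stdl) _; rewrite mulr0 scale0r.
- by apply: etrans (linear0 stdl) _; rewrite mul0r scale0r.
- by apply: etrans (linear0 stdl) _; rewrite mul0r scale0r.
Qed.

Lemma tmap2_nqstar (f : QS -> QS -> QS) (s t : {malg k[(ordpart *
  ordpart)%type]}) :
  tmap2 f (nqstar unit qprec qsucc qbullet) s t = tmap2 f qstar s t.
Proof.
apply: eq_bigr => a _; apply: eq_bigr => b _.
by congr (_ *: tens _ _); exact: nqstarE.
Qed.

Lemma eq_tmap (f f' g g' : QS -> QS) (t : {malg k[(ordpart * ordpart)%type]}) :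
  f =1 f' -> g =1 g' -> tmap f g t = tmap f' g' t.
Proof. by move=> ff gg; apply: eq_tmap_on => s _; [exact: ff|exact: gg]. Qed.

(** By the counit laws, the coefficient of the coproduct at a pair containing the unit is a
    coefficient of [p]. One of the two subtracted tensors cancels it, and the other contributes 0
    because [p] lies in [A]. *)
Lemma qredcoprod_AA p : in_A unit p -> in_AA unit (redcoprod unit qDelta p).
Proof.
move=> pA I J IJ; pose sub (a b : k) := a - b.
apply: etrans (mcoeffB _ _ _) _.
apply: etrans (congr2 sub (mcoeffB _ _ _) (mcoeff_tens _ _ _ _)) _.
apply: etrans (congr1 (sub^~ _) (congr1 (sub _) (mcoeff_tens _ _ _ _))) _.
rewrite /sub.
case/orP: IJ => /eqP->.
  apply: etrans (congr1 (fun a => a - _ - _) (esym (mcoeff_counit_l _ _ _))) _.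
  by rewrite qDelta_counit_l [p@_unit]pA mul0r subr0 !mcoeffU eqxx mul1r subrr.
apply: etrans (congr1 (fun a => a - _ - _) (esym (mcoeff_counit_r _ _ _))) _.
by rewrite qDelta_counit_r [p@_unit]pA mulr0 subr0 !mcoeffU eqxx mulr1 subrr.
Qed.

Lemma initialD n m : initial n `|` shiftp n @` initial m = initial (n + m).
Proof.
apply/fsetP => i; rewrite inE !in_initial;
  apply/orP/idP => [[|/imfsetP[j /=]]|].
- by move=> /leq_trans; apply; rewrite leq_addr.
- by rewrite in_initial => jm -> /=; rewrite addnC leq_add2l.
case: (leqP (val i) n) => [|lt_ni] le_i; [by left|right].
have gt0 : (0 < val i - n)%N by rewrite subn_gt0.
apply/imfsetP; exists (Sub (val i - n)%N gt0).
  by rewrite /= in_initial /= leq_subLR.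
by apply: val_inj; rewrite /= subnK // ltnW.
Qed.

(** Each word of [u] is squarefree with variables exactly those of index 1 to [n], hence already
    standard. *)
Lemma emb_stdl n (u : TW) : homog (x_set (initial n)) u -> emb (stdl u) = u.
Proof.
move=> hu; apply: (eq_linear_on (f := emb \o stdl) (g := id)) =>
  [c s t|//|w wu].
  by rewrite /= !linearP.
have sq : sqfree (wcontent w) by rewrite (hu _ wu); exact: sqfree_x_set.
rewrite /= stdlU emb1; congr << _ >>; rewrite val_std // (@st_blocks_id n).
  exact: sqfree_suppK.
by rewrite -finsupp_wcontent (hu _ wu) supp_x_set.
Qed.

Lemma emb_qop o I J : natural_op o ->
  emb (qop o << I >> << J >>) =
    o (x_seq (val I)) (x_seq (shift (deg I) (val J))) :> TW.
Proof.
move=> on; apply: etrans (congr1 emb (qopU _ _ _)) _.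
apply: (@emb_stdl (deg I + deg J));
  have := on.1 (x_seq (val I)) (shifted (deg I) J).
rewrite wcontent_ordpart wcontent_shifted -x_setU ?initialD //.
have [sq _] : separated (wcontent (shifted 0 I)) (wcontent (shifted (deg I) J)).
  exact: separated_shifted.
by have := sqfree_disjoint sq;
  rewrite shifted0 wcontent_ordpart wcontent_shifted !supp_x_set.
Qed.

(** On words of squarefree content, [stdl] followed by [emb] is [st_f], and every part of a cut of
    the word of an ordered partition is such a word. *)
Lemma emb_qDelta p : tmap emb emb (qDelta p) = tmap st_f st_f (Delta_f (emb p)).
Proof.
move: p; apply: (eq_linear (f := fun p => tmap emb emb (qDelta p))
  (g := fun p => tmap st_f st_f (Delta_f (emb p)))) => [c p q|c p q|I].
- by rewrite !linearP.
- by rewrite !linearP.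
rewrite qDeltaU emb1 Delta_fU (linear_sum (tmap emb emb)) (linear_sum (tmap
  st_f st_f)) /=.
apply: eq_big_seq => -[v w] sv.
have sq : sqfree (mmul (wcontent v) (wcontent w)).
  by rewrite -(splits_content sv) wcontent_ordpart; exact: sqfree_x_set.
apply: etrans (tmapU _ _ _ _) _; apply: etrans _ (esym (tmapU _ _ _ _)).
apply: congr2; rewrite emb1 val_std; first by apply: esym; exact: linextU.
- exact: sqfree_mull sq.
- by apply: esym; exact: linextU.
- exact: sqfree_mulr sq.
Qed.

Lemma qnqsh_algebra : nqsh_algebra unit qprec qsucc qbullet.
Proof.
have P := @wprec_natural k; have S := @wsucc_natural k;
  have M := @wbullet_natural k.
have T := @wstar_natural k.
split; try by move=> *; exact: qop_bilinear.
- by move=> p q pA _; exact: qop_closed.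
- by move=> p q pA _; exact: qop_closed.
- by move=> p q pA _; exact: qop_closed.
- by move=> p q r _ _ _; exact: (qop_axiom M M M M (@bullet_fA k)).
- move=> p q r _ _ _; rewrite nqstarE.
  exact: (qop_axiom P P P T (@prec_f_prec k)).
- by move=> p q r _ _ _; exact: (qop_axiom P S S P (@succ_f_prec k)).
- move=> p q r _ _ _; rewrite nqstarE.
  exact: (qop_axiom S T S S (@star_f_succ k)).
- by move=> p q r _ _ _; exact: (qop_axiom M P M S (@prec_f_bullet k)).
- by move=> p q r _ _ _; exact: (qop_axiom M S S M (@succ_f_bullet k)).
- by move=> p q r _ _ _; exact: (qop_axiom P M M P (@bullet_f_prec k)).
Qed.

Lemma qnqsh_unital : nqsh_unital unit qprec qsucc qbullet.
Proof.
split.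
- by move=> p _; exact: qbullet1x.
- by move=> p _; exact: qbulletx1.
- by move=> p _; exact: qprec1x.
- exact: qprecx1.
- exact: qsucc1x.
- by move=> p _; exact: qsuccx1.
- exact: qprec1x.
- exact: qsuccx1.
- exact: qbullet1x.
Qed.

Local Notation T := (redcoprod unit qDelta).

(** The summands are those of [redcoprod_op]: [a], [u], [v] and [w] are the ones where the operation
    meets the unit, to be evaluated; [d], [b] and [c] remain. *)
Lemma sum_eq7 (V : zmodType) (s a b c d u v w a' u' v' w' : V) :
  s = d + a + b + c + u + v + w -> a = a' -> u = u' -> v = v' -> w = w' ->
  s = d + a' + b + c + u' + v' + w'.
Proof. by move=> -> -> -> -> ->. Qed.

Lemma qredcoprod_prec p q : in_A unit p -> in_A unit q ->
  T (qprec p q) = tmap2 qprec qstar (T p) (T q) + tmap id (qstar^~ q) (T p)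
    + tmap (qprec p) id (T q) + tmap (qprec^~ q) id (T p) + tens p q.
Proof.
move=> pA qA.
have E := redcoprod_op (qop_bilinear _) (qop_bilinear _) qstar1x qstarx1
  (qprec1x _) (qDelta_qop p q (@wprec_natural k) (@Delta_wprec k)).
apply: etrans (sum_eq7 E _ _ _ _) _.
- exact: tmap_in_AAl (qredcoprod_AA pA) qprecx1.
- by apply: tmap_in_AA0 (qredcoprod_AA qA) _ => r _; exact: qprec1x.
- exact: (congr1 (fun z : QS => tens z q) (qprecx1 pA)).
- exact: etrans (congr1 (fun z => tens z p) (qprec1x q)) (linear0l _ _).
have drop0 (V : zmodType) (d a b c v : V) : d + a + b + c + 0 + v + 0 =
  d + a + b + c + v.
  by rewrite !addr0.
exact: drop0.
Qed.

Lemma qredcoprod_succ p q : in_A unit p -> in_A unit q ->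
  T (qsucc p q) = tmap2 qsucc qstar (T p) (T q) + tmap id (qstar p) (T q)
    + tmap (qsucc p) id (T q) + tmap (qsucc^~ q) id (T p) + tens q p.
Proof.
move=> pA qA.
have E := redcoprod_op (qop_bilinear _) (qop_bilinear _) qstar1x qstarx1
  (qsuccx1 _) (qDelta_qop p q (@wsucc_natural k) (@Delta_wsucc k)).
apply: etrans (sum_eq7 E _ _ _ _) _.
- by apply: tmap_in_AA0 (qredcoprod_AA pA) _ => r _; exact: qsuccx1.
- exact: tmap_in_AAl (qredcoprod_AA qA) qsucc1x.
- exact: etrans (congr1 (fun z => tens z q) (qsuccx1 p)) (linear0l _ _).
- exact: (congr1 (fun z : QS => tens z p) (qsucc1x qA)).
have drop0 (V : zmodType) (d b c u w : V) : d + 0 + b + c + u + 0 + w =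
  d + u + b + c + w.
  by rewrite !addr0 (AC 5 (1*4*2*3*5)).
exact: drop0.
Qed.

Lemma qredcoprod_bullet p q : in_A unit p -> in_A unit q ->
  T (qbullet p q) = tmap2 qbullet qstar (T p) (T q)
    + tmap (qbullet^~ q) id (T p) + tmap (qbullet p) id (T q).
Proof.
move=> pA qA.
have E := redcoprod_op (qop_bilinear _) (qop_bilinear _) qstar1x qstarx1
  (qbullet1x _) (qDelta_qop p q (@wbullet_natural k) (@Delta_wbullet k)).
apply: etrans (sum_eq7 E _ _ _ _) _.
- by apply: tmap_in_AA0 (qredcoprod_AA pA) _ => r _; exact: qbulletx1.
- by apply: tmap_in_AA0 (qredcoprod_AA qA) _ => r _; exact: qbullet1x.
- exact: etrans (congr1 (fun z => tens z q) (qbulletx1 p)) (linear0l _ _).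
- exact: etrans (congr1 (fun z => tens z p) (qbullet1x q)) (linear0l _ _).
have drop0 (V : zmodType) (d b c : V) : d + 0 + b + c + 0 + 0 + 0 = d + c + b.
  by rewrite !addr0 addrAC.
exact: drop0.
Qed.

Lemma qnqsh_bialgebra : nqsh_bialgebra unit qprec qsucc qbullet qDelta.
Proof.
split.
- exact: qnqsh_algebra.
- exact: qnqsh_unital.
- exact: qDelta_linear.
- exact: qDelta_coassociative.
- exists (mcoeff unit); split; [|exact: qDelta_counit_l|exact: qDelta_counit_r].
  by move=> c p q; rewrite mcoeffD mcoeffZ.
- exact: qDelta1.
- exact: qredcoprod_AA.
- move=> p q pA qA; apply: etrans (qredcoprod_prec pA qA) _.
  do 3![apply: congr2; last exact: erefl]; apply: congr2.
    exact: esym (tmap2_nqstar _ _ _).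
  by apply: eq_tmap => r; [exact: erefl|exact: esym (nqstarE _ _)].
- move=> p q pA qA; apply: etrans (qredcoprod_succ pA qA) _.
  do 3![apply: congr2; last exact: erefl]; apply: congr2.
    exact: esym (tmap2_nqstar _ _ _).
  by apply: eq_tmap => r; [exact: erefl|exact: esym (nqstarE _ _)].
- move=> p q pA qA; apply: etrans (qredcoprod_bullet pA qA) _.
  do 2![apply: congr2; last exact: erefl].
  exact: esym (tmap2_nqstar _ _ _).
Qed.

End Bialgebra.

Theorem theorem18 (k : fieldType) :
  exists (prec succ bullet : QSh k -> QSh k -> QSh k)
         (Delta : QSh k -> {malg k[(ordpart * ordpart)%type]}),
    [/\ forall I J : ordpart, (1 <= deg I)%N -> (1 <= deg J)%N ->
          [/\ emb (prec << I >> << J >>) =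
                prec_f << x_seq (val I) >> << x_seq (shift (deg I) (val J)) >>,
              emb (succ << I >> << J >>) =
                succ_f << x_seq (val I) >> << x_seq (shift (deg I) (val J)) >> &
              emb (bullet << I >> << J >>) =
                bullet_f << x_seq (val I) >>
                         << x_seq (shift (deg I) (val J)) >>],
        forall x : QSh k,
          tmap emb emb (Delta x) = tmap st_f st_f (Delta_f (emb x)) &
        nqsh_bialgebra ordpart0 prec succ bullet Delta].
Proof.
exists (qop wprec), (qop wsucc), (qop wbullet), qDelta; split.
- move=> I J _ _; split.
  + exact: etrans (emb_qop _ _ (@wprec_natural k)) (esym (prec_fU _ _)).
  + exact: etrans (emb_qop _ _ (@wsucc_natural k)) (esym (succ_fU _ _)).
  + exact: etrans (emb_qop _ _ (@wbullet_natural k)) (esym (bullet_fU _ _)).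
- exact: emb_qDelta.
- exact: qnqsh_bialgebra.
Qed.
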